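(* Let $G$ be a complex Lie group with Lie algebra $\mathfrak{g}$, equipped with a left-invariant holomorphic Riemannian metric $q$. Let $A$ be an open domain in $\mathbb{C}$, let $\gamma:A\to G$ be an immersed holomorphic curve, and let $x:A\to\mathfrak{g}$ be its associated curve $x(t)=D_{\gamma(t)}L_{\gamma(t)^{-1}}\,\dot\gamma(t)$. Then $\gamma$ is a geodesic if and only if, for every $t\in A$, $$\dot x(t)=\mathrm{ad}_{x(t)}^{\dagger}\,x(t),$$ where $\mathrm{ad}_{x(t)}^{\dagger}$ denotes the formal adjoint of $\mathrm{ad}_{x(t)}$ with respect to $q$.
   Context: A holomorphic (Riemannian) metric on a complex manifold is a holomorphic section of the symmetric square of the holomorphic cotangent bundle that is non-degenerate (as a complex bilinear form) at every point; it has a unique torsion-free metric holomorphic Levi-Civita connection $\nabla$. A holomorphic curve $\gamma$ is immersed if $\dot\gamma(t)\neq0$ for all $t$, and is a geodesic if $\nabla_{\dot\gamma}\dot\gamma=0$. $L_g$ is left translation by $g$; $\mathfrak{g}=T_eG$ is identified with left-invariant vector fields, and $\mathrm{ad}_xy=[x,y]$. The adjoint is defined by $q(\mathrm{ad}_x^\dagger y,z)=q(y,\mathrm{ad}_xz)$ for all $y,z\in\mathfrak{g}$. *)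

(* Defs.v *)
From HB Require Import structures.
From mathcomp Require Import all_boot all_order all_algebra complex.
From mathcomp Require Import all_classical all_reals all_analysis.

Set Implicit Arguments.
Unset Strict Implicit.
Unset Printing Implicit Defensive.

Import Order.TTheory GRing.Theory Num.Theory numFieldNormedType.Exports.

Local Open Scope ring_scope.
Local Open Scope classical_set_scope.

(* [R[i]] packaged as a numFieldType: the topology and the norm of
   MathComp-Analysis are attached to that structure.  With it,
   [differentiable f z] is complex (Frechet) differentiability and ['d f z] is
   the complex differential, so that a map is holomorphic on an open set iff it
   is [differentiable] at each of its points. *)
Definition Cplx (R : realType) : numFieldType := R[i].

HB.structure Definition TopologicalSpaceGroup :=
  {G of Group G & Topological G}.

Section Manifold.
Variables (R : realType) (n : nat).
Local Notation C := (Cplx R).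
Local Notation V := 'rV[C]_n.

Record chart (M : topologicalType) := Chart {
  chart_dom : set M;
  chart_map : M -> V;
  chart_inv : V -> M;
  chart_dom_open : open chart_dom;
  chart_img_open : open (chart_map @` chart_dom);
  chart_mapK : forall p, chart_dom p -> chart_inv (chart_map p) = p;
  chart_map_cts : forall p, chart_dom p -> {for p, continuous chart_map};
  chart_inv_cts : forall z, (chart_map @` chart_dom) z ->
                    {for z, continuous chart_inv} }.

(* [chart_at p] is a preferred chart around [p].  The tangent space T_pM is
   modelled by C^n through [chart_at p]: the vector [v : V], seen in T_pM, is
   the velocity at 0 of [s |-> chart_inv (chart_at p) (chart_map (chart_at p) p
   + s *: v)]. *)
Record complex_manifold (M : topologicalType) := ComplexManifold {
  atlas : set (chart M);
  chart_at : M -> chart M;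
  chart_at_atlas : forall p, atlas (chart_at p);
  chart_at_dom : forall p, chart_dom (chart_at p) p;
  transition_hol : forall phi psi p, atlas phi -> atlas psi ->
    chart_dom phi p -> chart_dom psi p ->
    differentiable (chart_map psi \o chart_inv phi) (chart_map phi p);
  manifold_hausdorff : hausdorff_space M }.

Section OnManifold.
Variables (M : topologicalType) (S : complex_manifold M).
Implicit Types (phi psi : chart M) (p : M) (u v : V) (U : set M).

(* Components in [phi] of [v] in T_pM, and conversely the element of T_pM
   whose components in [phi] are [u]. *)
Definition to_chart phi p v : V :=
  'd (chart_map phi \o chart_inv (chart_at S p))
     (chart_map (chart_at S p) p) v.
Definition of_chart phi p u : V :=
  'd (chart_map (chart_at S p) \o chart_inv phi) (chart_map phi p) u.

Definition hol_map U (f : M -> M) : Prop :=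
  forall p, U p -> {for p, continuous f} /\
    forall phi psi, atlas S phi -> atlas S psi ->
      chart_dom phi p -> chart_dom psi (f p) ->
      differentiable (chart_map psi \o f \o chart_inv phi) (chart_map phi p).

(* The differential T_pM -> T_{f p}M. *)
Definition mdiff (f : M -> M) p v : V :=
  'd (chart_map (chart_at S (f p)) \o f \o chart_inv (chart_at S p))
     (chart_map (chart_at S p) p) v.

Definition hol_fun U (f : M -> C) : Prop :=
  forall phi p, atlas S phi -> U p -> chart_dom phi p ->
    differentiable (f \o chart_inv phi) (chart_map phi p).

Definition fun_diff (f : M -> C) p v : C :=
  'd (f \o chart_inv (chart_at S p)) (chart_map (chart_at S p) p) v.

(* A vector field is a function [X : M -> V] with [X p] read in T_pM; local
   fields are total functions whose values off their domain are irrelevant. *)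
Definition field_in phi (X : M -> V) (z : V) : V :=
  to_chart phi (chart_inv phi z) (X (chart_inv phi z)).

Definition hol_field U (X : M -> V) : Prop :=
  forall phi p, atlas S phi -> U p -> chart_dom phi p ->
    differentiable (field_in phi X) (chart_map phi p).

(* [X, Y] = XY - YX, i.e. dY(X) - dX(Y) in the chart [chart_at S p]. *)
Definition lie_bracket (X Y : M -> V) p : V :=
  let phi := chart_at S p in
  'd (field_in phi Y) (chart_map phi p) (X p) -
  'd (field_in phi X) (chart_map phi p) (Y p).

(* The field with constant components [u] in the chart [phi]. *)
Definition coord_field phi u : M -> V := fun p => of_chart phi p u.

Record hol_metric (q : M -> V -> V -> C) : Prop := HolMetric {
  metric_linear : forall p u (a : C) v w,
    q p u (a *: v + w) = a * q p u v + q p u w;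
  metric_sym : forall p u v, q p u v = q p v u;
  metric_nondeg : forall p u, (forall v, q p u v = 0) -> u = 0;
  metric_hol : forall phi u v, atlas S phi ->
    hol_fun (chart_dom phi)
      (fun p => q p (coord_field phi u p) (coord_field phi v p)) }.

(* A holomorphic affine connection: [nabla X p v] is nabla_v X for [v] in T_pM
   and [X] a holomorphic field near [p]. *)
Record hol_connection (nabla : (M -> V) -> M -> V -> V) : Prop :=
 HolConnection {
  nabla_linear : forall U X, open U -> hol_field U X ->
    forall p (a : C) v w, U p ->
      nabla X p (a *: v + w) = a *: nabla X p v + nabla X p w;
  nabla_hol : forall U X Y, open U -> hol_field U X -> hol_field U Y ->
    hol_field U (fun p => nabla Y p (X p));
  nabla_add : forall U X Y, open U -> hol_field U X -> hol_field U Y ->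
    forall p v, U p ->
      nabla (fun r => X r + Y r) p v = nabla X p v + nabla Y p v;
  nabla_leibniz : forall U f X, open U -> hol_fun U f -> hol_field U X ->
    forall p v, U p ->
      nabla (fun r => f r *: X r) p v =
      fun_diff f p v *: X p + f p *: nabla X p v;
  nabla_local : forall U X Y, open U -> hol_field U X -> hol_field U Y ->
    (forall p, U p -> X p = Y p) ->
    forall p v, U p -> nabla X p v = nabla Y p v }.

Definition torsion_free (nabla : (M -> V) -> M -> V -> V) : Prop :=
  forall U X Y, open U -> hol_field U X -> hol_field U Y ->
  forall p, U p -> nabla Y p (X p) - nabla X p (Y p) = lie_bracket X Y p.

Definition metric_connection (q : M -> V -> V -> C)
    (nabla : (M -> V) -> M -> V -> V) : Prop :=
  forall U X Y, open U -> hol_field U X -> hol_field U Y ->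
  forall p v, U p ->
    fun_diff (fun r => q r (X r) (Y r)) p v =
    q p (nabla X p v) (Y p) + q p (X p) (nabla Y p v).

Definition levi_civita (q : M -> V -> V -> C)
    (nabla : (M -> V) -> M -> V -> V) : Prop :=
  [/\ hol_connection nabla, torsion_free nabla & metric_connection q nabla].

Section Curves.
Variables (A : set C) (gamma : C -> M).

Definition hol_curve : Prop :=
  forall t, A t -> {for t, continuous gamma} /\
    forall psi, atlas S psi -> chart_dom psi (gamma t) ->
      differentiable (chart_map psi \o gamma) t.

Definition velocity (t : C) : V :=
  derive1 (chart_map (chart_at S (gamma t)) \o gamma) t.

Definition immersed : Prop := forall t, A t -> velocity t != 0.

(* Covariant derivative of the field [W] along [gamma] ([W t] in T_{gamma t}M):
   if W = sum_i w_i e_i in the coordinate frame (e_i) of the chart at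
   [gamma t], then DW/dt = sum_i (w_i' e_i + w_i nabla_{gamma'} e_i). *)
Definition covariant_derivative (nabla : (M -> V) -> M -> V -> V)
    (W : C -> V) (t : C) : V :=
  let phi := chart_at S (gamma t) in
  derive1 (fun s => to_chart phi (gamma s) (W s)) t +
  \sum_(i < n) W t ord0 i *:
     nabla (coord_field phi (delta_mx ord0 i)) (gamma t) (velocity t).

Definition geodesic (nabla : (M -> V) -> M -> V -> V) : Prop :=
  forall t, A t -> covariant_derivative nabla velocity t = 0.

End Curves.
End OnManifold.

Record complex_lie_group (G : TopologicalSpaceGroup.type) := ComplexLieGroup {
  lie_manifold :> complex_manifold G;
  lie_mul_cts : continuous (fun z : G * G => (z.1 * z.2)%g);
  lie_mul_hol : forall phi psi chi (g h : G),
    atlas lie_manifold phi -> atlas lie_manifold psi ->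
    atlas lie_manifold chi ->
    chart_dom phi g -> chart_dom psi h -> chart_dom chi (g * h)%g ->
    differentiable
      (fun z : V * V => chart_map chi (chart_inv phi z.1 * chart_inv psi z.2)%g)
      (chart_map phi g, chart_map psi h);
  lie_inv_hol : hol_map lie_manifold setT (fun g : G => g^-1%g) }.

Section LieGroup.
Variables (G : TopologicalSpaceGroup.type) (S : complex_lie_group G).

Definition left_translation (g : G) : G -> G := fun h => (g * h)%g.

Definition left_invariant_metric (q : G -> V -> V -> C) : Prop :=
  forall (g p : G) (u v : V),
    q (left_translation g p) (mdiff S (left_translation g) p u)
      (mdiff S (left_translation g) p v) = q p u v.

(* The left-invariant field whose value at 1 is [x]. *)
Definition left_field (x : V) (g : G) : V := mdiff S (left_translation g) 1%g x.

(* The Lie algebra is T_1G, with the bracket of left-invariant fields. *)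
Definition ad (x y : V) : V := lie_bracket S (left_field x) (left_field y) 1%g.

Definition associated_curve (gamma : C -> G) (t : C) : V :=
  mdiff S (left_translation (gamma t)^-1%g) (gamma t) (velocity S gamma t).

(* [adjoint b f y] is the vector [w] with b(w, z) = b(y, f z) for all [z]; it
   exists and is unique as soon as [b] is bilinear and nondegenerate and [f] is
   linear. *)
Definition adjoint (b : V -> V -> C) (f : V -> V) (y : V) : V :=
  xget 0 [set w | forall z, b w z = b y (f z)].

End LieGroup.
End Manifold.

(* Main.v *)
(* Write x(t) for the associated curve, p = gamma(t), and let X be the
   left-invariant field with X(1) = x(t).  Since gamma' = sum_j x_j E_j(gamma) in
   a left-invariant frame (E_j), the covariant derivative of gamma' at t is the
   left translate of x'(t) plus nabla_X X (p).  As q is constant on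
   left-invariant fields, Koszul's formula gives q(nabla_X X, Z) = - q(X, [X, Z])
   for left-invariant Z, i.e. nabla_X X is the left translate of - ad_x^+ x;
   nondegeneracy of q concludes.

   Holomorphic means complex differentiable at every point, so all the second
   derivatives involved have to be produced: Goursat's theorem, pulled back by
   the exponential, yields Cauchy's formula for the first differential, from
   which the differential is Lipschitz, then differentiable, with a symmetric
   second differential.  The symmetry makes the bracket of left-invariant fields
   left-invariant. *)

Require Import Defs.
From HB Require Import structures.
From mathcomp Require Import all_boot all_order all_algebra complex.
From mathcomp Require Import all_classical all_reals all_analysis.
From mathcomp Require Import ring lra.
Import Order.TTheory GRing.Theory Num.Theory numFieldNormedType.Exports.
Local Open Scope ring_scope.
Local Open Scope classical_set_scope.

Set Implicit Arguments.
Unset Strict Implicit.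
Unset Printing Implicit Defensive.

(** The axioms of a connection only speak about holomorphic fields, and a left-invariant field is
    itself a first differential of the multiplication. So its mere holomorphy is already a
    second-order statement, and the same is true of coordinate fields and of the associated curve.

    Preferred charts may jump from one point to the next. Anything that depends on a moving tangent
    vector is therefore transported to one fixed chart before it is differentiated, and chart
    identities, valid only near a point, are passed to differentials as equalities of germs.

    Geodesics are defined through a coordinate frame, whereas Koszul's formula lives on
    left-invariant fields. Both leave the same connection terms, so no Christoffel symbol is
    computed and the velocity is never extended to a field.

    Integrals and the mean value theorem are applied to real and imaginary parts separately, which
    costs factors 2; no sharp constant is needed. *)

Definition cRe (R : realType) (z : Cplx R) : R := complex.Re (z : R[i]).
Definition cIm (R : realType) (z : Cplx R) : R := complex.Im (z : R[i]).
Definition cR (R : realType) (x : R) : Cplx R := real_complex R x.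
Definition cI (R : realType) : Cplx R := Complex 0 1.

(** * Real and imaginary parts *)

Section ReIm.
Variable R : realType.
Implicit Types (z w : Cplx R) (x y : R).

Lemma cReIm_inj z w : cRe z = cRe w -> cIm z = cIm w -> z = w.
Proof. by case: z w => [a b] [c d] /= -> ->. Qed.

Lemma cReD z w : cRe (z + w) = cRe z + cRe w. Proof. by case: z w => ? ? []. Qed.
Lemma cImD z w : cIm (z + w) = cIm z + cIm w. Proof. by case: z w => ? ? []. Qed.
Lemma cReN z : cRe (- z) = - cRe z. Proof. by case: z. Qed.
Lemma cImN z : cIm (- z) = - cIm z. Proof. by case: z. Qed.
Lemma cReM z w : cRe (z * w) = cRe z * cRe w - cIm z * cIm w.
Proof. by case: z w => ? ? []. Qed.
Lemma cImM z w : cIm (z * w) = cRe z * cIm w + cIm z * cRe w.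
Proof. by case: z w => ? ? []. Qed.
Lemma cRe_cR x : cRe (cR x) = x. Proof. by []. Qed.
Lemma cIm_cR x : cIm (cR x) = 0. Proof. by []. Qed.
Lemma cRe_cI : cRe (cI R) = 0. Proof. by []. Qed.
Lemma cIm_cI : cIm (cI R) = 1. Proof. by []. Qed.

Definition cE := (cReD, cImD, cReN, cImN, cReM, cImM, cRe_cR, cIm_cR, cRe_cI, cIm_cI).

Lemma cRD x y : cR (x + y) = cR x + cR y. Proof. exact: rmorphD. Qed.
Lemma cRN x : cR (- x) = - cR x. Proof. exact: rmorphN. Qed.
Lemma cRM x y : cR (x * y) = cR x * cR y. Proof. exact: rmorphM. Qed.
Lemma cRV x : cR x^-1 = (cR x)^-1. Proof. exact: fmorphV. Qed.
Lemma cR0 : cR (0 : R) = 0. Proof. by []. Qed.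
Lemma cR1 : cR (1 : R) = 1. Proof. by []. Qed.

Lemma ler_cR x y : (cR x <= cR y) = (x <= y). Proof. exact: lecR. Qed.
Lemma ltr_cR x y : (cR x < cR y) = (x < y). Proof. exact: ltcR. Qed.

Lemma cR_real (k : Cplx R) : k \is Num.real -> k = cR (cRe k).
Proof. by move=> kr; rewrite /cR /cRe RRe_real. Qed.

Lemma cR_gt0 (k : Cplx R) : 0 < k -> k = cR (cRe k).
Proof. by move=> k0; apply: cR_real; apply: gtr0_real. Qed.

Lemma cRE z : z = cR (cRe z) + cI R * cR (cIm z).
Proof. by apply: cReIm_inj; rewrite !cE; ring. Qed.

End ReIm.

(* The norm of a normed module over [Cplx R] takes its values in [Cplx R]; [nm]
   is the same norm with values in [R]. *)
Definition nm (R : realType) (V : normedModType (Cplx R)) (v : V) : R :=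
  cRe `|v|.

(** * Real-valued norms and differentiability in epsilon-delta form *)

Section RealNorm.
Variable R : realType.
Local Notation C := (Cplx R).

Section Module.
Variable V : normedModType C.
Implicit Types u v : V.

Lemma nmE v : `|v| = (cR (nm v)).
Proof. by apply: cR_real; apply: normr_real. Qed.

Lemma nm_ge0 v : 0 <= nm v.
Proof. by have := normr_ge0 v; rewrite nmE ler_cR. Qed.

Lemma nmD u v : nm (u + v) <= nm u + nm v.
Proof. by have := ler_normD u v; rewrite !nmE -cRD ler_cR. Qed.

Lemma nmN v : nm (- v) = nm v.
Proof. by rewrite /nm normrN. Qed.

Lemma nmB u v : nm (u - v) <= nm u + nm v.
Proof. by rewrite -(nmN v) nmD. Qed.

Lemma nm0 : nm (0 : V) = 0.
Proof. by rewrite /nm normr0. Qed.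

Lemma nm_eq0 v : nm v = 0 -> v = 0.
Proof. by move=> v0; apply/eqP; rewrite -normr_eq0 nmE v0. Qed.

Lemma nmZ (a : C) v : nm (a *: v) = nm (a : C^o) * nm v.
Proof.
have := normrZ a v; rewrite -[X in X * _]/(`|a : C^o|) !nmE -cRM.
by move/complexI.
Qed.

End Module.

Section Scalar.
Implicit Types z w : C^o.

Lemma nmM z w : nm (z * w : C^o) = nm z * nm w.
Proof. exact: nmZ. Qed.

Lemma nmV z : nm (z^-1 : C^o) = (nm z)^-1.
Proof. by have := normfV (z : C); rewrite -![`|_|]/(`|_ : C^o|) !nmE -cRV => /complexI. Qed.

Lemma nmR (x : R) : nm ((cR x) : C^o) = `|x|.
Proof. by rewrite /nm normc_def /= expr0n /= addr0 sqrtr_sqr. Qed.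

Lemma nm_cplx z : nm z = Num.sqrt (cRe z ^+ 2 + cIm z ^+ 2).
Proof. by rewrite /nm normc_def. Qed.

Lemma ler_Re_nm z : `|cRe z| <= nm z.
Proof.
by rewrite nm_cplx -sqrtr_sqr; apply: ler_wsqrtr; rewrite lerDl sqr_ge0.
Qed.

Lemma ler_Im_nm z : `|cIm z| <= nm z.
Proof.
by rewrite nm_cplx -sqrtr_sqr; apply: ler_wsqrtr; rewrite lerDr sqr_ge0.
Qed.

Lemma ler_nm_ReIm z : nm z <= `|cRe z| + `|cIm z|.
Proof.
rewrite nm_cplx -[leRHS]ger0_norm ?addr_ge0 // -sqrtr_sqr; apply: ler_wsqrtr.
rewrite sqrrD !real_normK ?num_real // addrAC lerDl mulrn_wge0 //.

Qed.

End Scalar.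

Lemma nbhs_nmP (V : normedModType C) (v : V) (P : set V) :
  nbhs v P <-> exists2 d : R, 0 < d & forall h, nm h < d -> P (v + h).
Proof.
split.
  case/nbhs_normP => e /= e0 eP.
  have eR : e = cR (cRe e) by exact: cR_gt0.
  exists (cRe e); first by rewrite -ltr_cR -eR.
  move=> h hd; apply: eP; rewrite /ball_ /= opprD addNKr normrN.
  by rewrite nmE eR ltr_cR.
case=> d d0 dP; apply/nbhs_normP; exists (cR d); first by rewrite /= ltr_cR.
move=> w; rewrite /ball_ /= distrC nmE ltr_cR => /dP.
by rewrite addrC subrK.
Qed.

Section Diff.
Variables V W : normedModType C.
Implicit Types (f : V -> W) (z : V).

Lemma differentiable_nm f z : differentiable f z ->
  forall e : R, 0 < e -> exists2 d : R, 0 < d &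
    forall h, nm h < d -> nm (f (z + h) - f z - 'd f z h) <= e * nm h.
Proof.
move=> /diff_locally /eqaddoP fz e e0.
have := fz (cR e); rewrite ltr_cR => /(_ e0) /nbhs_nmP[d d0 dP].
exists d => // h /dP; rewrite add0r !fctE /=.
by rewrite !nmE -cRM ler_cR opprD addrA [h + z]addrC.
Qed.

Lemma diff_nm_bound f z : differentiable f z ->
  exists2 K : R, 0 < K & forall h, nm ('d f z h) <= K * nm h.
Proof.
move=> /diff_continuous /linear_lipschitz[k k0 kP].
have kR : k = cR (cRe k) by exact: cR_gt0.
exists (cRe k); first by rewrite -ltr_cR -kR.
by move=> h; have := kP h; rewrite kR !nmE -cRM ler_cR.
Qed.

(** The bound by [K] makes the candidate [T] continuous, which linearity alone does not give in an
    arbitrary normed module. *)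
Lemma nm_differentiable f z (T : V -> W) (K : R) : linear T ->
  (forall h, nm (T h) <= K * nm h) ->
  (forall e : R, 0 < e -> exists2 d : R, 0 < d &
    forall h, nm h < d -> nm (f (z + h) - f z - T h) <= e * nm h) ->
  differentiable f z /\ 'd f z = T :> (V -> W).
Proof.
move=> Tlin TK fT.
pose TM := GRing.isLinear.Build _ _ _ _ _ Tlin.
pose L : {linear V -> W} := HB.pack T TM.
have Lc : continuous L.
  apply/linear_bounded_continuous/linear_boundedP.
  near=> r => h; rewrite (nmE (L h)).
  have rR : r = cR (cRe r).
    by apply: cR_gt0; near: r; apply: nbhs_pinfty_gt; rewrite real0.
  rewrite rR nmE -cRM ler_cR (le_trans (TK h)) // ler_wpM2r ?nm_ge0 //.
  move: (rR); rewrite -ler_cR => <-; near: r; apply: nbhs_pinfty_ge.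
  by apply/complex_realP; exists K.
have fL : f \o shift z = cst (f z) + L +o_ 0 id.
  apply/eqaddoP => /= _/posnumP[e].
  have eR : e%:num = cR (cRe e%:num) by exact: cR_gt0.
  have [|d d0 dP] := fT (cRe e%:num); first by rewrite -ltr_cR -eR cR0.
  apply/nbhs_nmP; exists d => // h /dP; rewrite add0r => H.
  rewrite eR !nmE -cRM ler_cR; apply: le_trans H.
  by rewrite !fctE /= opprD addrA [h + z]addrC.
have dL : 'd f z = L :> (V -> W) by apply: diff_unique.
split => //; apply/diff_locallyP; rewrite dL; split => //.
Unshelve. all: by end_near. Qed.

End Diff.
End RealNorm.

(** * Integrals of continuous real functions on a segment *)

Section RealIntegral.
Variable R : realType.
Local Notation mu := (@lebesgue_measure R).
Implicit Types (a b c : R) (f g : R -> R).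

(** Continuity is two-sided even at the end points. The integrands below satisfy this, and it
    composes without subspace topologies. *)
Definition cts_on (T : topologicalType) a b (f : R -> T) :=
  forall x, a <= x <= b -> {for x, continuous f}.

(** Not oriented: the value is 0 when b < a, hence the hypotheses a <= b. *)
Definition rint a b f : R := Rintegral mu `[a, b] f.

Lemma cts_on_within a b f : cts_on a b f -> {within `[a, b], continuous f}.
Proof.
by move=> cf; apply: continuous_in_subspaceT => x; rewrite inE /= in_itv /= => /cf.
Qed.

Lemma cts_on_integrable a b f : cts_on a b f -> mu.-integrable `[a, b] (EFin \o f).
Proof.
move=> cf; apply: continuous_compact_integrable; first exact: segment_compact.
exact: cts_on_within.
Qed.

Lemma rintD a b f g : cts_on a b f -> cts_on a b g ->
  rint a b (fun x => f x + g x) = rint a b f + rint a b g.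
Proof. by move=> cf cg; apply: RintegralD => //; apply: cts_on_integrable. Qed.

Lemma rintZ a b k f : cts_on a b f ->
  rint a b (fun x => k * f x) = k * rint a b f.
Proof. by move=> cf; apply: RintegralZl => //; apply: cts_on_integrable. Qed.

Lemma eq_rint a b f g : (forall x, a <= x <= b -> f x = g x) ->
  rint a b f = rint a b g.
Proof. by move=> fg; apply: eq_Rintegral => x; rewrite inE /= in_itv /= => /fg. Qed.

Lemma rint_cst a b k : a <= b -> rint a b (fun=> k) = k * (b - a).
Proof.
move=> ab; rewrite /rint Rintegral_cst //; congr (_ * _).
have := @lebesgue_measure_itv R (Interval (BLeft a) (BRight b)); rewrite /= lte_fin => ->.
by case: ltgtP ab => // -> _; rewrite subrr.
Qed.

Lemma rint_bound a b f M : a <= b -> cts_on a b f ->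
  (forall x, a <= x <= b -> `|f x| <= M) -> `|rint a b f| <= M * (b - a).
Proof.
move=> ab cf fM; rewrite -rint_cst //.
have cs (k : R) : cts_on a b (fun=> k) by move=> x _; apply: cst_continuous.
have cN : cts_on a b (fun x => - f x) by move=> x /cf; apply: continuousN.
rewrite ler_norml; apply/andP; split; last first.
  apply: le_Rintegral; rewrite ?cts_on_integrable //.
  by move=> x; rewrite /= in_itv /= => /fM; apply: le_trans; apply: ler_norm.
rewrite lerNl -mulN1r -rintZ //; under eq_rint do rewrite mulN1r.
apply: le_Rintegral; rewrite ?cts_on_integrable //.
by move=> x; rewrite /= in_itv /= => /fM; apply: le_trans; rewrite -normrN ler_norm.
Qed.

Lemma rint_cat a b c f : a <= b -> b <= c -> cts_on a c f ->
  rint a b f + rint b c f = rint a c f.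
Proof.
move=> ab bc cf.
have := @Rintegral_itvB R f (BLeft a) (BRight c) b (cts_on_integrable cf).
rewrite !bnd_simp => /(_ ab bc) /eqP.
rewrite subr_eq addrC => /eqP; rewrite -/(rint a c f) => ->.
congr (_ + _); rewrite /rint Rintegral_itv_obnd_cbnd //.
have cbc : cts_on b c f by move=> x /andP[bx xc]; apply: cf; rewrite xc (le_trans ab).
apply: integrableS (cts_on_integrable cbc) => //.
by apply: subset_itvr; rewrite bnd_simp.
Qed.

Lemma rint_affine a b (p k : R) : a <= b ->
  rint a b (fun x => p + k * x) = p * (b - a) + k * ((b ^+ 2 - a ^+ 2) / 2).
Proof.
have cid : cts_on a b (fun x => x) by move=> x _; apply: cvg_id.
have cs (j : R) : cts_on a b (fun=> j) by move=> x _; apply: cst_continuous.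
move=> ab; rewrite rintD //; last first.
  by move=> x _; apply: mulrl_continuous.
rewrite rint_cst // rintZ //; congr (_ + _ * _).
(* The fundamental theorem of calculus asks for a < b, so the one-point segment is treated apart. *)
move: ab; rewrite le_eqVlt => /orP[/eqP <-|ab].
  by rewrite /rint set_itv1 Rintegral_set1 subrr mul0r.
pose F : R -> R := 2^-1 *: (@id R) ^+ 2.
have dF (x : R) : is_derive x 1 F x.
  apply: is_derive_eq; rewrite /GRing.scale /= expr1 /GRing.scale /=.
  by rewrite -mulr_natl; field.
rewrite /rint /Rintegral (@continuous_FTC2 _ _ F a b ab).
- by rewrite -EFinB /= /F /= !fctE /GRing.scale /=; lra.
- exact: cts_on_within.
- have cF x : {for x, continuous F}.
    by apply/differentiable_continuous/derivable1_diffP; case: (dF x).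
  split.
  + by move=> x _; case: (dF x).
  + by apply: cvg_at_right_filter; apply: cF.
  + by apply: cvg_at_left_filter; apply: cF.
- by move=> x _; rewrite derive1E; case: (dF x).
Qed.

End RealIntegral.

(** * Integrals of complex-valued functions of a real variable *)

Section ComplexIntegral.
Variable R : realType.
Local Notation C := (Cplx R).
Implicit Types (a b c : R) (f g : R -> C).

Lemma cts_nmP f (x : R) : {for x, continuous f} <->
  forall e : R, 0 < e -> exists2 d : R, 0 < d &
    forall y, `|y - x| < d -> nm (f y - f x : C^o) < e.
Proof.
split=> [cf e e0|cf].
  have /cf : nbhs (f x) [set z | nm (z - f x : C^o) < e].
    apply/(@nbhs_nmP R C^o); exists e => // h he /=.
    by rewrite addrC addKr.
  case/nbhs_normP => d d0 dP; exists d => // y yd.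
  by apply: dP; rewrite /ball_ /= distrC.
move=> P /(@nbhs_nmP R C^o)[e /cf[d d0 dP] eP].
apply/nbhs_normP; exists d => // y; rewrite /ball_ /= distrC => /dP /eP.
by rewrite addrC subrK.
Qed.

Lemma cts_cR : continuous (@cR R).
Proof.
move=> x; apply/cts_nmP => e e0; exists e => // y yx.
by rewrite -cRN -cRD nmR.
Qed.

Lemma cts_cRe : continuous (@cRe R).
Proof.
move=> z P /nbhs_normP[e e0 eP]; apply/(@nbhs_nmP R C^o); exists e => // h he.
apply: eP; rewrite /ball_ /= cReD opprD addNKr normrN.
exact: le_lt_trans (ler_Re_nm _) he.
Qed.

Lemma cts_cIm : continuous (@cIm R).
Proof.
move=> z P /nbhs_normP[e e0 eP]; apply/(@nbhs_nmP R C^o); exists e => // h he.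
apply: eP; rewrite /ball_ /= cImD opprD addNKr normrN.
exact: le_lt_trans (ler_Im_nm _) he.
Qed.

Definition ccts_on a b f := forall x, a <= x <= b -> {for x, continuous f}.

Lemma cts_on_Re a b f : ccts_on a b f -> cts_on a b (fun x => cRe (f x)).
Proof. by move=> cf x /cf fx; apply: continuous_comp fx _; apply: cts_cRe. Qed.

Lemma cts_on_Im a b f : ccts_on a b f -> cts_on a b (fun x => cIm (f x)).
Proof. by move=> cf x /cf fx; apply: continuous_comp fx _; apply: cts_cIm. Qed.

Lemma ccts_onM a b f g : ccts_on a b f -> ccts_on a b g ->
  ccts_on a b (fun x => f x * g x).
Proof. by move=> cf cg x xab; apply: (@continuousM C); [apply: cf|apply: cg]. Qed.

Lemma ccts_on_cst a b (k : C) : ccts_on a b (fun=> k).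
Proof. by move=> x _; apply: cst_continuous. Qed.

Definition cint a b f : C :=
  cR (rint a b (fun x => cRe (f x))) + cI R * cR (rint a b (fun x => cIm (f x))).

Lemma cRe_cint a b f : cRe (cint a b f) = rint a b (fun x => cRe (f x)).
Proof. by rewrite /cint !cE; ring. Qed.

Lemma cIm_cint a b f : cIm (cint a b f) = rint a b (fun x => cIm (f x)).
Proof. by rewrite /cint !cE; ring. Qed.

Lemma eq_cint a b f g : (forall x, a <= x <= b -> f x = g x) ->
  cint a b f = cint a b g.
Proof.
move=> fg; apply: cReIm_inj; rewrite ?cRe_cint ?cIm_cint;
  by apply: eq_rint => x /fg ->.
Qed.

Lemma cintD a b f g : ccts_on a b f -> ccts_on a b g ->
  cint a b (fun x => f x + g x) = cint a b f + cint a b g.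
Proof.
move=> cf cg; apply: cReIm_inj.
  rewrite cRe_cint [RHS]cReD !cRe_cint -rintD; [|exact: cts_on_Re..].
  by apply: eq_rint => x _; rewrite cReD.
rewrite cIm_cint [RHS]cImD !cIm_cint -rintD; [|exact: cts_on_Im..].
by apply: eq_rint => x _; rewrite cImD.
Qed.

Lemma cintZ a b k f : ccts_on a b f ->
  cint a b (fun x => k * f x) = k * cint a b f.
Proof.
move=> cf; have cRf := cts_on_Re cf; have cIf := cts_on_Im cf.
have cZ (j : R) h : cts_on a b h -> cts_on a b (fun x => j * h x).
  move=> ch x /ch; apply: continuousM; exact: cst_continuous.
apply: cReIm_inj.
  rewrite cRe_cint [RHS]cReM cRe_cint cIm_cint -mulNr -!rintZ //.
  rewrite -rintD; [|exact: cZ..].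
  by apply: eq_rint => x _; rewrite cReM mulNr.
rewrite cIm_cint [RHS]cImM cRe_cint cIm_cint -!rintZ // -rintD; [|exact: cZ..].
by apply: eq_rint => x _; rewrite cImM.
Qed.

Lemma cintB a b f g : ccts_on a b f -> ccts_on a b g ->
  cint a b (fun x => f x - g x) = cint a b f - cint a b g.
Proof.
move=> cf cg.
rewrite (@eq_cint _ _ _ (fun x => f x + -1 * g x)); last first.
  by move=> x _; rewrite mulN1r.
have cN : ccts_on a b (fun x => -1 * g x).
  exact: (@ccts_onM a b (fun=> -1) g (@ccts_on_cst a b _) cg).
by rewrite (cintD cf cN) (cintZ (-1) cg) mulN1r.
Qed.

(** The factor 2 comes from bounding the real and imaginary parts one by one. *)
Lemma cint_bound a b f M : a <= b -> ccts_on a b f ->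
  (forall x, a <= x <= b -> nm (f x : C^o) <= M) ->
  nm (cint a b f : C^o) <= 2 * (M * (b - a)).
Proof.
move=> ab cf fM; apply: le_trans (ler_nm_ReIm _) _.
rewrite cRe_cint cIm_cint mulr_natl mulr2n lerD // rint_bound //.
- exact: cts_on_Re.
- by move=> x /fM; apply: le_trans; apply: ler_Re_nm.
- exact: cts_on_Im.
- by move=> x /fM; apply: le_trans; apply: ler_Im_nm.
Qed.

Lemma cint_cat a b c f : a <= b -> b <= c -> ccts_on a c f ->
  cint a b f + cint b c f = cint a c f.
Proof.
move=> ab bc cf; apply: cReIm_inj.
  by rewrite [LHS]cReD !cRe_cint; apply: rint_cat => //; exact: cts_on_Re.
by rewrite [LHS]cImD !cIm_cint; apply: rint_cat => //; exact: cts_on_Im.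
Qed.

Lemma cint_affine a b (p k : C) : a <= b ->
  cint a b (fun x => p + k * cR x) =
  p * cR (b - a) + k * cR ((b ^+ 2 - a ^+ 2) / 2).
Proof.
move=> ab; apply: cReIm_inj.
  rewrite cRe_cint !cE !mulr0 !subr0 -rint_affine //.
  by apply: eq_rint => x _; rewrite !cE; ring.
rewrite cIm_cint !cE !mulr0 !add0r -rint_affine //.
by apply: eq_rint => x _; rewrite !cE; ring.
Qed.

End ComplexIntegral.

(** * Integrals along the boundary of a rectangle *)

Section Goursat.
Variable R : realType.
Local Notation C := (Cplx R).
Implicit Types (f g : C -> C).

Definition cpt (x y : R) : C := cR x + cI R * cR y.

Lemma cts_cptx (y : R) : continuous (cpt^~ y).
Proof.
move=> x; apply: (@continuousD _ C^o); first exact: cts_cR.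
exact: cst_continuous.
Qed.

Lemma cts_cpty (x : R) : continuous (cpt x).
Proof.
rewrite /cpt => y; apply: (@continuousD _ C^o _ (fun=> cR x) (fun y => cI R * cR y)).
  exact: cst_continuous.
by apply: (@continuousM C); [exact: cst_continuous|exact: cts_cR].
Qed.

Lemma cRe_cpt (x y : R) : cRe (cpt x y) = x.
Proof. by rewrite /cpt !cE; ring. Qed.

Lemma cIm_cpt (x y : R) : cIm (cpt x y) = y.
Proof. by rewrite /cpt !cE; ring. Qed.

Definition rect (x0 x1 y0 y1 : R) : set C :=
  [set z | x0 <= cRe z <= x1 /\ y0 <= cIm z <= y1].

(** The integral of g(z) dz along the boundary, run counterclockwise from the lower left corner: dz
    is dx on horizontal sides and i dy on vertical ones. *)
Definition rect_int g (x0 x1 y0 y1 : R) : C :=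
  cint x0 x1 (fun x => g (cpt x y0)) + cI R * cint y0 y1 (fun y => g (cpt x1 y))
  - cint x0 x1 (fun x => g (cpt x y1)) - cI R * cint y0 y1 (fun y => g (cpt x0 y)).

Definition cts_rect g x0 x1 y0 y1 :=
  forall z, rect x0 x1 y0 y1 z -> {for z, continuous g}.

Lemma rect_cpt x0 x1 y0 y1 x y : x0 <= x <= x1 -> y0 <= y <= y1 ->
  rect x0 x1 y0 y1 (cpt x y).
Proof.
by move=> xx yy; split; rewrite ?cRe_cpt ?cIm_cpt.
Qed.

Section Cts.
Variables (g : C -> C) (x0 x1 y0 y1 : R).
Hypothesis cg : cts_rect g x0 x1 y0 y1.

Lemma cts_rectx y : y0 <= y <= y1 -> ccts_on x0 x1 (fun x => g (cpt x y)).
Proof.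
move=> yy x xx; apply: (@continuous_comp _ _ _ (cpt^~ y) g).
  exact: cts_cptx.
by apply: cg; apply: rect_cpt.
Qed.

Lemma cts_recty x : x0 <= x <= x1 -> ccts_on y0 y1 (fun y => g (cpt x y)).
Proof.
move=> xx y yy; apply: (@continuous_comp _ _ _ (cpt x) g).
  exact: cts_cpty.
by apply: cg; apply: rect_cpt.
Qed.
End Cts.

Lemma rect_intD f g x0 x1 y0 y1 : x0 <= x1 -> y0 <= y1 ->
  cts_rect f x0 x1 y0 y1 -> cts_rect g x0 x1 y0 y1 ->
  rect_int (fun z => f z + g z) x0 x1 y0 y1 =
  rect_int f x0 x1 y0 y1 + rect_int g x0 x1 y0 y1.
Proof.
move=> xx yy cf cg.
have Hx y : y0 <= y <= y1 -> cint x0 x1 (fun x => f (cpt x y) + g (cpt x y)) =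
    cint x0 x1 (fun x => f (cpt x y)) + cint x0 x1 (fun x => g (cpt x y)).
  by move=> yb; apply: cintD; [exact: cts_rectx cf _ yb|exact: cts_rectx cg _ yb].
have Hy x : x0 <= x <= x1 -> cint y0 y1 (fun y => f (cpt x y) + g (cpt x y)) =
    cint y0 y1 (fun y => f (cpt x y)) + cint y0 y1 (fun y => g (cpt x y)).
  by move=> xb; apply: cintD; [exact: cts_recty cf _ xb|exact: cts_recty cg _ xb].
rewrite /rect_int !Hx ?Hy ?lexx ?xx ?yy //.
move: (cint _ _ _) (cint _ _ _) (cint _ _ _) (cint _ _ _) => I1 I2 I3 I4.
move: (cint _ _ _) (cint _ _ _) (cint _ _ _) (cint _ _ _) => I5 I6 I7 I8.
ring.
Qed.

(** Twice [M] times the perimeter, with the factor 2 of [cint_bound]. *)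
Lemma rect_int_bound g x0 x1 y0 y1 M : x0 <= x1 -> y0 <= y1 ->
  cts_rect g x0 x1 y0 y1 ->
  (forall z, rect x0 x1 y0 y1 z -> nm (g z : C^o) <= M) ->
  nm (rect_int g x0 x1 y0 y1 : C^o) <= 4 * M * ((x1 - x0) + (y1 - y0)).
Proof.
move=> xx yy cg gM.
have Hx y : y0 <= y <= y1 ->
    nm (cint x0 x1 (fun x => g (cpt x y)) : C^o) <= 2 * (M * (x1 - x0)).
  move=> yb; apply: cint_bound => //; first exact: cts_rectx cg _ yb.
  by move=> x xb; apply: gM; apply: rect_cpt.
have Hy x : x0 <= x <= x1 ->
    nm (cI R * cint y0 y1 (fun y => g (cpt x y)) : C^o) <= 2 * (M * (y1 - y0)).
  move=> xb; rewrite nmM (_ : nm (cI R : C^o) = 1); last first.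
    by rewrite nm_cplx cRe_cI cIm_cI expr0n expr1n add0r sqrtr1.
  rewrite mul1r; apply: cint_bound => //; first exact: cts_recty cg _ xb.
  by move=> y yb; apply: gM; apply: rect_cpt.
rewrite /rect_int; apply: le_trans (nmB _ _) _.
apply: le_trans (lerD (nmB _ _) (lexx _)) _.
apply: le_trans (lerD (lerD (nmD _ _) (lexx _)) (lexx _)) _.
have := Hx y0; have := Hx y1; have := Hy x0; have := Hy x1.
rewrite !lexx xx yy /= => /(_ isT) h1 /(_ isT) h2 /(_ isT) h3 /(_ isT) h4.
lra.
Qed.

(** Lets Goursat's argument discard the first-order approximation and estimate the remainder
    only. *)
Lemma rect_int_affine (p k : C) x0 x1 y0 y1 : x0 <= x1 -> y0 <= y1 ->
  rect_int (fun z => p + k * z) x0 x1 y0 y1 = 0.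
Proof.
move=> xx yy.
have Hx y : cint x0 x1 (fun x => p + k * cpt x y) =
    (p + k * cI R * cR y) * cR (x1 - x0) + k * cR ((x1 ^+ 2 - x0 ^+ 2) / 2).
  by rewrite -cint_affine //; apply: eq_cint => x _; rewrite /cpt; ring.
have Hy x : cint y0 y1 (fun y => p + k * cpt x y) =
    (p + k * cR x) * cR (y1 - y0) + k * cI R * cR ((y1 ^+ 2 - y0 ^+ 2) / 2).
  by rewrite -cint_affine //; apply: eq_cint => y _; rewrite /cpt; ring.
rewrite /rect_int !Hx !Hy; apply: cReIm_inj; rewrite !cE; ring.
Qed.

(** The inner sides are run twice, in opposite directions. *)
Lemma rect_int_split g x0 xm x1 y0 ym y1 :
  x0 <= xm <= x1 -> y0 <= ym <= y1 -> cts_rect g x0 x1 y0 y1 ->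
  rect_int g x0 x1 y0 y1 =
  rect_int g x0 xm y0 ym + rect_int g xm x1 y0 ym +
  rect_int g x0 xm ym y1 + rect_int g xm x1 ym y1.
Proof.
move=> /andP[x0m xm1] /andP[y0m ym1] cg.
have x01 := le_trans x0m xm1; have y01 := le_trans y0m ym1.
have Hx y : y0 <= y <= y1 -> cint x0 x1 (fun x => g (cpt x y)) =
    cint x0 xm (fun x => g (cpt x y)) + cint xm x1 (fun x => g (cpt x y)).
  by move=> yb; rewrite cint_cat //; apply: cts_rectx cg _ yb.
have Hy x : x0 <= x <= x1 -> cint y0 y1 (fun y => g (cpt x y)) =
    cint y0 ym (fun y => g (cpt x y)) + cint ym y1 (fun y => g (cpt x y)).
  by move=> xb; rewrite cint_cat //; apply: cts_recty cg _ xb.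
rewrite /rect_int !Hx ?Hy ?lexx ?x01 ?y01 //.
move: (cint _ _ _) (cint _ _ _) (cint _ _ _) (cint _ _ _) => I1 I2 I3 I4.
move: (cint _ _ _) (cint _ _ _) (cint _ _ _) (cint _ _ _) => I5 I6 I7 I8.
move: (cint _ _ _) (cint _ _ _) (cint _ _ _) (cint _ _ _) => I9 I10 I11 I12.
ring.
Qed.

End Goursat.

(** * Goursat's theorem *)

Lemma nested_intervals (R : realType) (a b : nat -> R) :
  (forall n, a n <= a n.+1) -> (forall n, b n.+1 <= b n) ->
  (forall n, a n <= b n) -> exists X, forall n, a n <= X <= b n.
Proof.
move=> aS bS ab.
have am m n : (m <= n)%N -> a m <= a n.
  by move/subnK <-; elim: (n - m)%N => // k IH; apply: le_trans IH (aS _).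
have bm m n : (m <= n)%N -> b n <= b m.
  by move/subnK <-; elim: (n - m)%N => // k IH; apply: le_trans (bS _) IH.
have abmn m n : a m <= b n.
  case: (leqP m n) => [/am h|/ltnW /bm h]; first exact: le_trans h (ab n).
  exact: le_trans (ab m) h.
have hs : has_sup (range a).
  split; first by exists (a 0%N), 0%N.
  by exists (b 0%N) => _ [m _ <-].
exists (sup (range a)) => n; apply/andP; split.
  by apply: sup_ubound; [case: hs|exists n].
by apply: sup_le_ub; [case: hs|move=> _ [m _ <-]].
Qed.

Lemma exists_half_pow_lt (R : realType) (M d : R) : 0 < d -> exists n, M * 2^-1 ^+ n < d.
Proof.
move=> d0.
have h : (fun n => M * 2^-1 ^+ n : R) @ \oo --> (0 : R).
  rewrite -[0 in X in _ --> X](mulr0 M).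
  apply: cvgMr; apply: cvg_expr; rewrite ger0_norm ?invr_ge0 //; lra.
have /cvgrPdist_lt /(_ d d0) [n _ nP] := h.
exists n; have := nP n (leqnn n); rewrite /= sub0r normrN.
exact: le_lt_trans (ler_norm _).
Qed.

Lemma norm_sub_le_itv (R : realDomainType) (a w s t : R) :
  a <= s <= a + w -> a <= t <= a + w -> `|s - t| <= w.
Proof.
by move=> /andP[s1 s2] /andP[t1 t2]; rewrite ler_norml; apply/andP; split; lra.
Qed.

Section GoursatTheorem.
Variable R : realType.
Local Notation C := (Cplx R).

Definition cdiff (g : C -> C) (z : C) := exists c : C,
  forall e : R, 0 < e -> exists2 d : R, 0 < d &
    forall h : C, nm (h : C^o) < d ->
      nm (g (z + h) - g z - c * h : C^o) <= e * nm (h : C^o).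

Lemma differentiable_cdiff (g : C -> C) (z : C) :
  differentiable (g : C^o -> C^o) z -> cdiff g z.
Proof.
move=> dg; exists ('d (g : C^o -> C^o) z (1 : C^o)) => e e0.
have [d d0 dP] := differentiable_nm dg e0.
exists d => // h hd; have := dP h hd.
rewrite (_ : _ * h = 'd (g : C^o -> C^o) z h) //.
by rewrite -{2}[h]mulr1 [RHS]linearZ mulrC.
Qed.

Lemma cdiff_continuous (g : C -> C) (z : C) : cdiff g z -> {for z, continuous g}.
Proof.
case=> c gc P /(@nbhs_nmP R C^o)[e e0 eP].
have [d d0 dP] := gc 1 ltr01.
have K0 : 0 < 1 + nm (c : C^o) by rewrite ltr_pwDl ?nm_ge0.
apply/(@nbhs_nmP R C^o); exists (Num.min d (e / (1 + nm (c : C^o)))).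
  by rewrite lt_min d0 divr_gt0.
move=> h; rewrite lt_min => /andP[/dP hd he].
change (P (g (z + h))); rewrite (_ : g (z + h) = g z + (g (z + h) - g z)); last by ring.
apply: eP.
have -> : g (z + h) - g z = (g (z + h) - g z - c * h) + c * h by ring.
apply: le_lt_trans (nmD _ _) _.
apply: le_lt_trans (lerD hd (lexx _)) _.
by rewrite nmM -mulrDl mulrC -ltr_pdivlMr.
Qed.

(** Bisection keeps the boundary integral above [eps] times the area. Area is additive, so some
    quarter inherits a bound that the whole satisfies. At the common point of the rectangles,
    differentiability makes the integral small compared with the area, a contradiction. *)
Lemma goursat (g : C -> C) (x0 x1 y0 y1 : R) : x0 < x1 -> y0 < y1 ->
  (forall z, rect x0 x1 y0 y1 z -> cdiff g z) -> rect_int g x0 x1 y0 y1 = 0.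
Proof.
move=> x01 y01 dg; set W := rect_int g.
have cg : cts_rect g x0 x1 y0 y1 by move=> z /dg; apply: cdiff_continuous.
apply/eqP/contraT => /eqP Wn0.
set L := x1 - x0; set H := y1 - y0.
have L0 : 0 < L by rewrite subr_gt0.
have H0 : 0 < H by rewrite subr_gt0.
have W0 : 0 < nm (W x0 x1 y0 y1 : C^o).
  by rewrite lt_neqAle nm_ge0 andbT eq_sym; apply/eqP => /nm_eq0.
(* Half the ratio of integral to area, so that the strict bound in [inv] holds on the initial
   rectangle. *)
pose eps := nm (W x0 x1 y0 y1 : C^o) / (2 * (L * H)).
have LH0 : 0 < L * H by rewrite mulr_gt0.
have eps0 : 0 < eps by rewrite divr_gt0 // mulr_gt0.
pose r n : R := 2^-1 ^+ n.
have r0 n : 0 < r n by rewrite exprn_gt0 // invr_gt0.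
have rS n : r n = r n.+1 + r n.+1 by rewrite /r exprS; field.
pose Wq n (q : R * R) := W q.1 (q.1 + L * r n) q.2 (q.2 + H * r n).
pose inv n (q : R * R) := [/\ x0 <= q.1, q.1 + L * r n <= x1, y0 <= q.2,
  q.2 + H * r n <= y1 & eps * (L * r n * (H * r n)) < nm (Wq n q : C^o)].
(* The hypothesis [inv] sits under the existential so that [choice] yields a total selection
   function. *)
have step (nq : nat * (R * R)) : exists q', inv nq.1 nq.2 ->
    [/\ inv nq.1.+1 q', nq.2.1 <= q'.1, q'.1 + L * r nq.1.+1 <= nq.2.1 + L * r nq.1,
        nq.2.2 <= q'.2 & q'.2 + H * r nq.1.+1 <= nq.2.2 + H * r nq.1].
  case: nq => n [x y] /=.
  have l0 : 0 < L * r n.+1 by rewrite mulr_gt0.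
  have h0 : 0 < H * r n.+1 by rewrite mulr_gt0.
  have [[xx xL yy yH ib]|ni] := pselect (inv n (x, y)); last by exists (x, y) => /ni.
  move: xx xL yy yH ib; rewrite /inv /Wq /= rS !mulrDr.
  set l := L * r n.+1 in l0 *; set h := H * r n.+1 in h0 *.
  move=> xx xL yy yH ib.
  apply: contrapT => nex.
  (* If no quarter inherits the bound, each contributes at most [eps * (l * h)], and the four
     together cannot exceed [eps] times the area of the parent. *)
  have child x' y' : x <= x' -> x' + l <= x + (l + l) -> y <= y' ->
      y' + h <= y + (h + h) ->
      nm (W x' (x' + l) y' (y' + h) : C^o) <= eps * (l * h).
    move=> a1 a2 a3 a4; rewrite leNgt; apply/negP => bad; apply: nex.
    exists (x', y') => _; split => //; split => //=.
    - exact: le_trans xx a1.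
    - exact: le_trans a2 xL.
    - exact: le_trans yy a3.
    - exact: le_trans a4 yH.
  have := @rect_int_split R g x (x + l) (x + l + l) y (y + h) (y + h + h).
  rewrite -/W => Wsplit.
  move: ib; rewrite (addrA x l l) (addrA y h h) Wsplit; [|lra|lra|]; last first.
    move=> z [/andP[z1 z2] /andP[z3 z4]]; apply: cg; split; lra.
  move=> ib.
  have dbl (t k : R) : 0 < k -> [/\ t <= t + k, t + k <= t + (k + k) & t + k + k <= t + (k + k)].
    by move=> k0; split; [rewrite lerDl ltW|rewrite lerD2l lerDl ltW|rewrite addrA].
  have [x1a x2a x3a] := dbl x l l0; have [y1a y2a y3a] := dbl y h h0.
  have c1 := child x y (lexx _) x2a (lexx _) y2a.
  have c2 := child (x + l) y x1a x3a (lexx _) y2a.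
  have c3 := child x (y + h) (lexx _) x2a y1a y3a.
  have c4 := child (x + l) (y + h) x1a x3a y1a y3a.
  move: ib c1 c2 c3 c4; move: (W _ _ _ _) (W _ _ _ _) (W _ _ _ _) (W _ _ _ _).
  move=> W1 W2 W3 W4 ib c1 c2 c3 c4; move: ib; rewrite ltNge => /negP; apply.
  apply: le_trans (nmD _ _) _.
  apply: le_trans (lerD (nmD _ _) (lexx _)) _.
  apply: le_trans (lerD (lerD (nmD _ _) (lexx _)) (lexx _)) _.
  have -> : eps * ((l + l) * h) + eps * ((l + l) * h) = 4 * (eps * (l * h)) by ring.
  lra.
have [s sP] := choice step.
pose u := fix u n : R * R := if n is m.+1 then s (m, u m) else (x0, y0).
have uinv n : inv n (u n).
  elim: n => [|n IH]; last by case: (sP (n, u n) IH).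
  rewrite /inv /Wq /= /r expr0 !mulr1 /L /H !subrKC; split => //.
  rewrite -/L -/H (_ : eps * _ = nm (W x0 x1 y0 y1 : C^o) / 2).
    by rewrite ltr_pdivrMr // mulr_natr mulr2n ltrDl.
  by rewrite /eps; move: (nm _) => w; field; rewrite !gt_eqF.
have us n := sP (n, u n) (uinv n).
have [X XP] : exists X, forall n, (u n).1 <= X <= (u n).1 + L * r n.
  apply: nested_intervals => n; [by case: (us n)|by case: (us n)|].
  by rewrite lerDl ltW // mulr_gt0.
have [Y YP] : exists Y, forall n, (u n).2 <= Y <= (u n).2 + H * r n.
  apply: nested_intervals => n; [by case: (us n)|by case: (us n)|].
  by rewrite lerDl ltW // mulr_gt0.
have XYr : rect x0 x1 y0 y1 (cpt X Y).
  apply: rect_cpt; [have := XP 0%N|have := YP 0%N];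
  by rewrite /= /r expr0 mulr1 /L /H subrKC.
have [c cP] := dg _ XYr.
(* Chosen so that [rect_int_bound], with error at most [e * ((L + H) * r n)] on the n-th rectangle,
   gives exactly half of [eps] times its area. *)
pose e := eps * (L * H) / (8 * (L + H) ^+ 2).
have e0 : 0 < e.
  by apply: divr_gt0; apply: mulr_gt0 => //; apply: exprn_gt0; apply: addr_gt0.
have [d d0 dP] := cP e e0.
have [n nP] := exists_half_pow_lt (L + H) d0.
rewrite -/(r n) in nP.
have [a1 a2 a3 a4 a5] := uinv n; exfalso; move: a5; rewrite ltNge => /negP; apply.
(* [A] is the first-order approximation of [g] at the limit point, whose boundary integral vanishes;
   [B] is the remainder. *)
pose A z := g (cpt X Y) - c * cpt X Y + c * z.
pose B z := g z - A z.
set S := rect _ _ _ _ in cg dg.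
have cA z : {for z, continuous A}.
  apply: cdiff_continuous; exists c => k k0; exists 1 => // h _.
  rewrite (_ : _ - _ = 0 :> C) ?nm0 ?mulr_ge0 ?nm_ge0 ?ltW //.
  by rewrite /A; ring.
have sub z : rect (u n).1 ((u n).1 + L * r n) (u n).2 ((u n).2 + H * r n) z -> S z.
  by case=> /andP[z1 z2] /andP[z3 z4]; split; lra.
have cB z : S z -> {for z, continuous B}.
  move=> /cg gz; exact: (@continuousB _ C^o _ g A z gz (cA z)).
have -> : Wq n (u n) = rect_int (fun z => A z + B z)
    (u n).1 ((u n).1 + L * r n) (u n).2 ((u n).2 + H * r n).
  suff -> : (fun z => A z + B z) = g by [].
  by apply/funext => z; rewrite /B; move: (A z) (g z) => k j; rewrite addrC subrK.
have Lr0 : 0 < L * r n by rewrite mulr_gt0.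
have Hr0 : 0 < H * r n by rewrite mulr_gt0.
rewrite rect_intD; [|lra|lra|by move=> z _; apply: cA|by move=> z /sub /cB].
rewrite rect_int_affine; [|lra|lra].
rewrite add0r.
have := @rect_int_bound R B (u n).1 ((u n).1 + L * r n) (u n).2 ((u n).2 + H * r n)
  (e * ((L + H) * r n)).
set I := rect_int _ _ _ _ _ => HI.
have {HI} : nm (I : C^o) <= 4 * (e * ((L + H) * r n)) * (L * r n + H * r n).
  apply: le_trans (HI _ _ _ _) _; [lra|lra|by move=> z /sub /cB| |].
    move=> z [/andP[z1 z2] /andP[z3 z4]].
    have nz : nm (z - cpt X Y : C^o) <= (L + H) * r n.
      apply: le_trans (ler_nm_ReIm _) _.
      rewrite !cReD !cImD !cReN !cImN cRe_cpt cIm_cpt mulrDl.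
      apply: lerD; first by apply: (@norm_sub_le_itv _ (u n).1); rewrite ?z1 ?XP.
      by apply: (@norm_sub_le_itv _ (u n).2); rewrite ?z3 ?YP.
    have := dP (z - cpt X Y) (le_lt_trans nz nP).
    rewrite (_ : cpt X Y + (z - cpt X Y) = z); last by rewrite addrC subrK.
    move=> /le_trans h.
    rewrite (_ : B z = g z - g (cpt X Y) - c * (z - cpt X Y)); last first.
      by rewrite /B /A; ring.
    by apply: h; rewrite ler_wpM2l // ltW.
  by rewrite le_eqVlt; apply/orP; left; apply/eqP; ring.
move=> h; apply: le_trans h _.
have -> : 4 * (e * ((L + H) * r n)) * (L * r n + H * r n) =
   eps * (L * r n * (H * r n)) / 2.
  by rewrite /e; field; rewrite gt_eqF // addr_gt0.
have : 0 < eps * (L * r n * (H * r n)).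
  by apply: mulr_gt0 => //; apply: mulr_gt0.
move: (eps * _) => k; lra.
Qed.

End GoursatTheorem.

(** * Cauchy's formula on circles *)

Lemma is_derive_dominated (R : realType) (f : R -> R) (x df : R) :
  is_derive x 1 f df -> forall e : R, 0 < e -> exists2 d : R, 0 < d &
    forall h, `|h| < d -> `|f (h + x) - f x - h * df| <= e * `|h|.
Proof.
move=> fx e e0; have dx : derivable f x 1 by case: fx.
have /diff_locally /eqaddoP /(_ e e0) := (derivable1_diffP _ _).1 dx.
rewrite deriv1E // => /nbhs_normP[d d0 dP].
exists d => // h hd; have := dP h; rewrite /ball_ /= sub0r normrN => /(_ hd).
rewrite !fctE /= opprD addrA derive1E.
by have -> : 'D_1 f x = df by case: fx.
Qed.

Section ComplexExp.
Variable R : realType.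
Local Notation C := (Cplx R).

Definition cis (t : R) : C := cpt (cos t) (sin t).
Definition cexp (z : C) : C := cR (expR (cRe z)) * cis (cIm z).

Lemma cisD (s t : R) : cis (s + t) = cis s * cis t.
Proof.
apply: cReIm_inj; rewrite ?cReM ?cImM /cis !cRe_cpt !cIm_cpt ?cosD ?sinD //.
by rewrite addrC.
Qed.

Lemma nm_cis (t : R) : nm (cis t : C^o) = 1.
Proof. by rewrite nm_cplx cRe_cpt cIm_cpt cos2Dsin2 sqrtr1. Qed.

Lemma cts_cis : continuous cis.
Proof.
have cc : continuous (fun t : R => cR (cos t)).
  by move=> t; apply: (continuous_comp (@continuous_cos R t)); exact: cts_cR.
have cs : continuous (fun t : R => cI R * cR (sin t)).
  move=> t; apply: (@continuousM C R (fun=> cI R) (fun t => cR (sin t))).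
    exact: cst_continuous.
  by apply: (continuous_comp (@continuous_sin R t)); exact: cts_cR.
by move=> t; exact: (@continuousD C C^o R _ _ t (cc t) (cs t)).
Qed.

Lemma cexpD (z w : C) : cexp (z + w) = cexp z * cexp w.
Proof. by rewrite /cexp cReD cImD expRD cisD cRM; ring. Qed.

Lemma nm_cexp (z : C) : nm (cexp z : C^o) = expR (cRe z).
Proof. by rewrite /cexp nmM nm_cis mulr1 nmR ger0_norm // expR_ge0. Qed.

Lemma cexp_dominated (e : R) : 0 < e -> exists2 d : R, 0 < d &
  forall h : C, nm (h : C^o) < d -> nm (cexp h - 1 - h : C^o) <= e * nm (h : C^o).
Proof.
move=> e0; have e30 : 0 < e / 4 by rewrite divr_gt0.
have [d1 d10 H1] := is_derive_dominated (is_derive_expR 0) e30.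
have [d2 d20 H2] := is_derive_dominated (is_derive_cos 0) e30.
have [d3 d30 H3] := is_derive_dominated (is_derive_sin 0) e30.
have : {for (0 : R), continuous cis} by exact: cts_cis.
move/cts_nmP => /(_ _ e30)[d4 d40 H4].
exists (Num.min (Num.min d1 d2) (Num.min d3 d4)).
  by rewrite !lt_min d10 d20 d30 d40.
move=> h; rewrite !lt_min => /andP[/andP[h1 h2] /andP[h3 h4]].
set a := cRe h; set b := cIm h.
have ah : `|a| <= nm (h : C^o) by exact: ler_Re_nm.
have bh : `|b| <= nm (h : C^o) by exact: ler_Im_nm.
have := H1 a (le_lt_trans ah h1); rewrite addr0 expR0 mulr1 => {}H1.
have := H2 b (le_lt_trans bh h2); rewrite addr0 cos0 sin0 oppr0 mulr0 subr0 => {}H2.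
have := H3 b (le_lt_trans bh h3); rewrite addr0 cos0 sin0 subr0 mulr1 => {}H3.
have := H4 b; rewrite subr0 => /(_ (le_lt_trans bh h4)) {}H4.
have c0 : cis 0 = 1 by rewrite /cis cos0 sin0 /cpt cR0 cR1; ring.
rewrite c0 in H4.
(* With h = a + ib, the three terms vanish to higher order by the derivative of exp at 0, by those
   of cos and sin at 0, and by continuity of [cis]. The middle one counts twice, hence e / 4. *)
have -> : cexp h - 1 - h = cR (expR a - 1 - a) * cis b + (cis b - 1 - cI R * cR b)
    + cR a * (cis b - 1).
  rewrite /cexp -/a -/b !cRD !cRN cR1 {1}[h]cRE -/a -/b; ring.
apply: le_trans (nmD _ _) _; apply: le_trans (lerD (nmD _ _) (lexx _)) _.
rewrite !nmM nm_cis mulr1 !nmR.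
have K : nm (cis b - 1 - cI R * cR b : C^o) <= e / 4 * `|b| + e / 4 * `|b|.
  apply: le_trans (ler_nm_ReIm _) _; apply: lerD.
    rewrite (_ : cRe _ = cos b - 1) //.
    by rewrite /cis /cpt !cE; ring.
  rewrite (_ : cIm _ = sin b - b) //.
  by rewrite /cis /cpt !cE; ring.
have K2 : `|a| * nm (cis b - 1 : C^o) <= nm (h : C^o) * (e / 4).
  by apply: ler_pM => //; [exact: nm_ge0|exact: ltW].
have K3 : e / 4 * `|a| <= e / 4 * nm (h : C^o) by rewrite ler_wpM2l // ltW.
have K4 : e / 4 * `|b| <= e / 4 * nm (h : C^o) by rewrite ler_wpM2l // ltW.
apply: le_trans (lerD (lerD H1 K) K2) _.
move: K3 K4; clear; move: (nm _) `|a| `|b| => n x y K3 K4.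
have -> : e * n = 4 * (e / 4 * n) by field.
rewrite [n * _]mulrC; move: K3 K4; move: (_ * n) (_ * x) (_ * y) => p q s; lra.
Qed.

Lemma differentiable_cexp (z : C) : differentiable (cexp : C^o -> C^o) z.
Proof.
have lT : linear (fun h : C^o => cexp z * h : C^o).
  by move=> k u v; rewrite mulrDr -[k *: u]/(k * u) -[k *: (_ * u)]/(k * (_ * u)); ring.
have [] // := @nm_differentiable R C^o C^o cexp z _ (nm (cexp z : C^o)) lT.
  by move=> h; rewrite nmM.
move=> e e0; have nz : 0 < nm (cexp z : C^o) by rewrite nm_cexp expR_gt0.
have [d d0 dP] := cexp_dominated (divr_gt0 e0 nz).
exists d => // h /dP H.
rewrite cexpD (_ : _ - _ - _ = cexp z * (cexp h - 1 - h)); last by ring.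
rewrite nmM mulrC -ler_pdivlMr //; apply: le_trans H _.
by rewrite le_eqVlt; apply/orP; left; apply/eqP; ring.
Qed.

End ComplexExp.

Section Circle.
Variable R : realType.
Local Notation C := (Cplx R).
Implicit Types (F : C -> C) (r : R).

Definition twopi : R := pi *+ 2.

Lemma twopi_gt0 : 0 < twopi.
Proof. by rewrite /twopi pmulrn_lgt0 // pi_gt0. Qed.

(** 2 pi times the mean of [F] on the circle, i.e. the integral of F(z) dz / (iz). *)
Definition circ r F : C := cint 0 twopi (fun t => F (cR r * cis t)).

Definition cts_circ r F := forall z : C, nm (z : C^o) = r -> {for z, continuous F}.

Lemma nm_circ r (t : R) : 0 <= r -> nm (cR r * cis t : C^o) = r.
Proof. by move=> r0; rewrite nmM nm_cis mulr1 nmR ger0_norm. Qed.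

Lemma cts_circ_on r F : 0 <= r -> cts_circ r F ->
  ccts_on 0 twopi (fun t => F (cR r * cis t)).
Proof.
move=> r0 cF t _; apply: (@continuous_comp _ _ _ (fun t => cR r * cis t) F).
  apply: (@continuousM C R (fun=> cR r) (@cis R)); first exact: cst_continuous.
  exact: cts_cis.
by apply: cF; rewrite nm_circ.
Qed.

Lemma eq_circ r F G : 0 <= r -> (forall z : C, nm (z : C^o) = r -> F z = G z) ->
  circ r F = circ r G.
Proof. by move=> r0 FG; apply: eq_cint => t _; apply: FG; rewrite nm_circ. Qed.

Lemma circB r F G : 0 <= r -> cts_circ r F -> cts_circ r G ->
  circ r (fun z => F z - G z) = circ r F - circ r G.
Proof. by move=> r0 cF cG; apply: cintB; apply: cts_circ_on. Qed.

Lemma circD r F G : 0 <= r -> cts_circ r F -> cts_circ r G ->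
  circ r (fun z => F z + G z) = circ r F + circ r G.
Proof. by move=> r0 cF cG; apply: cintD; apply: cts_circ_on. Qed.

Lemma circZ r (k : C) F : 0 <= r -> cts_circ r F ->
  circ r (fun z => k * F z) = k * circ r F.
Proof. by move=> r0 cF; apply: cintZ; apply: cts_circ_on. Qed.

Lemma circ_bound r F M : 0 <= r -> cts_circ r F ->
  (forall z : C, nm (z : C^o) = r -> nm (F z : C^o) <= M) ->
  nm (circ r F : C^o) <= 2 * (M * twopi).
Proof.
move=> r0 cF FM; rewrite -[X in M * X]subr0.
apply: cint_bound; first exact: ltW twopi_gt0.
  exact: cts_circ_on.
by move=> t _; apply: FM; rewrite nm_circ.
Qed.

(* The substitution [z = exp w] turns concentric circles into the two vertical
   sides of a rectangle of height [2 pi], whose horizontal sides cancel. *)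
Lemma circ_const F (rho s r : R) : 0 < s -> s < r -> r < rho ->
  (forall z : C, z != 0 -> nm (z : C^o) < rho -> differentiable (F : C^o -> C^o) z) ->
  circ r F = circ s F.
Proof.
move=> s0 sr rrho dF.
have r0 : 0 < r by exact: lt_trans sr.
have [x xE] := expR_total s0; have [y yE] := expR_total r0.
have xy : x < y by rewrite -ltr_expR xE yE.
have := @goursat R (fun w => F (cexp w)) x y 0 twopi xy twopi_gt0.
have side t (z : R) : cexp (cpt z t) = cR (expR z) * cis t :> C.
  by rewrite /cexp cRe_cpt cIm_cpt.
have cis2 : cis twopi = cis 0 :> C.
  by rewrite /cis /twopi cos2pi sin2pi cos0 sin0.
have H : forall z, rect x y 0 twopi z -> cdiff (fun w => F (cexp w)) z.
  move=> z [/andP[_ zy] _]; apply: differentiable_cdiff.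
  change (differentiable ((F : C^o -> C^o) \o (@cexp R : C^o -> C^o)) z).
  apply: differentiable_comp.
    exact: differentiable_cexp.
  apply: dF; last by rewrite nm_cexp (le_lt_trans _ rrho) // -yE ler_expR.
  apply/eqP => z0; have := nm_cexp z; rewrite z0 nm0 => /eqP.
  by rewrite eq_sym gt_eqF // expR_gt0.
move=> /(_ H); rewrite /rect_int.
have -> : cint x y (fun x0 => F (cexp (cpt x0 twopi))) =
          cint x y (fun x0 => F (cexp (cpt x0 0))).
  by apply: eq_cint => z _; rewrite !side cis2.
have -> : cint 0 twopi (fun t => F (cexp (cpt y t))) = circ r F.
  by apply: eq_cint => t _; rewrite side yE.
have -> : cint 0 twopi (fun t => F (cexp (cpt x t))) = circ s F.
  by apply: eq_cint => t _; rewrite side xE.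
move: (cint _ _ _) (circ _ _) (circ _ _) => a c b abc.
have I2 : cI R * cI R = -1 by apply: cReIm_inj; rewrite !cE; ring.
have : cI R * (cI R * (b - c)) = 0 by rewrite -[RHS](mulr0 (cI R)) -abc; ring.
rewrite mulrA I2 mulN1r => /eqP; rewrite oppr_eq0 subr_eq0 => /eqP //.
Qed.

(** The radius can be shrunk until [F] is as close to [l] as desired. Only the limit at 0 enters,
    never the value [F 0], so [F] may take a junk value there. *)
Lemma circ_mean F (l : C) (rho r : R) : 0 < r -> r < rho ->
  (forall z : C, z != 0 -> nm (z : C^o) < rho -> differentiable (F : C^o -> C^o) z) ->
  (forall e : R, 0 < e -> exists2 d : R, 0 < d & forall z : C, z != 0 ->
     nm (z : C^o) < d -> nm (F z - l : C^o) <= e) ->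
  circ r F = cR twopi * l.
Proof.
move=> r0 rrho dF Fl; apply/eqP; rewrite -subr_eq0; apply/eqP/(@nm_eq0 R C^o).
apply/eqP; rewrite eq_le nm_ge0 andbT; rewrite leNgt; apply/negP.
set e := nm _ => e0; suff : e <= e / 2 by lra.
have e20 : 0 < e / 2 by rewrite divr_gt0.
have p0 := twopi_gt0.
(* With this tolerance the bound of [circ_bound] on the small circle is exactly e / 2. *)
have [d d0 dP] := Fl (e / 2 / (2 * twopi)) (divr_gt0 e20 (mulr_gt0 (ltr0Sn _ 1) p0)).
pose s := Num.min r d / 2.
have m0 : 0 < Num.min r d by rewrite lt_min r0 d0.
have s0 : 0 < s by rewrite divr_gt0.
have sm : s < Num.min r d by rewrite /s; lra.
have [sr sd] : s < r /\ s < d by move: sm; rewrite lt_min => /andP.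
rewrite {1}/e (circ_const s0 sr rrho dF); move: e20 dP; move: (e / 2) => k k0 dP.
have neq (z : C) : nm (z : C^o) = s -> z != 0.
  by move=> zs; apply/eqP => z0; move: s0; rewrite -zs z0 nm0 ltxx.
have cF : cts_circ s F.
  move=> z zs; apply: (@differentiable_continuous _ C^o C^o); apply: dF; first exact: neq.
  by rewrite zs (lt_trans sr).
have cl : cts_circ s (fun=> l) by move=> z _; apply: cst_continuous.
have <- : circ s (fun=> l) = cR twopi * l.
  have := @cint_affine R 0 twopi l 0 (ltW p0); rewrite mul0r addr0 subr0 mulrC => <-.
  by apply: eq_cint => t _; rewrite mul0r addr0.
rewrite -(circB (ltW s0) cF cl).
have -> : k = 2 * ((k / (2 * twopi)) * twopi).
  by rewrite mulrCA divfK // gt_eqF // mulr_gt0.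
apply: (@circ_bound s (fun z => F z - l) (k / (2 * twopi)) (ltW s0)).
  move=> z zs; exact: (@continuousB C C^o C _ _ z (cF z zs) (cl z zs)).
by move=> z zs; apply: dP; [exact: neq|rewrite zs].
Qed.

End Circle.

(** * Second derivatives of holomorphic maps *)

Lemma dominated_is_derive (R : realType) (f : R -> R) (x df : R) :
  (forall e : R, 0 < e -> exists2 d : R, 0 < d &
    forall h, `|h| < d -> `|f (h + x) - f x - h * df| <= e * `|h|) ->
  is_derive x 1 f df.
Proof.
move=> H.
have fl : (fun h : R => h^-1 *: ((f \o shift x) (h *: (1 : R)) - f x)) @ 0^' --> df.
  apply/cvgrPdist_le => e e0; have [d d0 dP] := H e e0.
  near=> h; have h0 : h != 0 by near: h; exact: nbhs_dnbhs_neq.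
  have hd : `|h| < d by near: h; exact: dnbhs0_lt.
  have := dP h hd; rewrite distrC -ler_pdivrMr ?normr_gt0 // -normf_div.
  rewrite /= -[h *: 1]/(h * 1) mulr1 -[_^-1 *: _]/(_^-1 * _).
  by congr (`|_| <= _); field.
split; first by apply/cvg_ex; exists df.
exact/cvg_lim.
Unshelve. all: by end_near. Qed.

Section SecondDerivative.
Variables (R : realType) (V : normedModType (Cplx R)).
Local Notation C := (Cplx R).
Implicit Types (f : V -> C^o) (z u h : V).

(** [g] stands for the real or the imaginary part: only real linearity and the bound by the norm
    matter. The real mean value theorem is applied along the segment from z to z + h. *)
Lemma mean_value_re f z h (a B : R) (g : C -> R) :
  (forall x y, g (x + y) = g x + g y) -> (forall x, g (- x) = - g x) ->
  (forall (k : R) x, g (cR k * x) = k * g x) -> (forall x, `|g x| <= nm (x : C^o)) ->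
  (forall s : R, 0 <= s <= 1 -> differentiable f (z + cR s *: h) /\
    `|g ('d f (z + cR s *: h) h) - a| <= B) ->
  `|g (f (z + h)) - g (f z) - a| <= B.
Proof.
move=> gD gN gZ gn H.
pose p s := g (f (z + cR s *: h)).
have dp (s : R) : 0 <= s <= 1 -> is_derive s 1 p (g ('d f (z + cR s *: h) h)).
  move=> s01; have [df _] := H s s01.
  apply: dominated_is_derive => e e0.
  (* The added 1 keeps the divisor positive when h = 0. *)
  have h1 : 0 < 1 + nm h by rewrite ltr_pwDl ?nm_ge0.
  have [d d0 dP] := differentiable_nm df (divr_gt0 e0 h1).
  exists (d / (1 + nm h)); first exact: divr_gt0.
  move=> k kd.
  have kh : nm (cR k *: h) <= `|k| * (1 + nm h).
    by rewrite nmZ nmR ler_wpM2l // lerDr.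
  have khd : nm (cR k *: h) < d.
    by apply: le_lt_trans kh _; rewrite -ltr_pdivlMr.
  have := dP _ khd => Hd.
  have -> : p (k + s) - p s - k * g ('d f (z + cR s *: h) h) =
     g (f (z + cR s *: h + cR k *: h) - f (z + cR s *: h) - 'd f (z + cR s *: h) (cR k *: h)).
    have -> : 'd f (z + cR s *: h) (cR k *: h) = cR k * 'd f (z + cR s *: h) h.
      by rewrite linearZ.
    rewrite !gD !gN gZ /p; congr (g (f _) - _ - _).
    by rewrite cRD scalerDl addrA addrAC.
  apply: le_trans (gn _) _; apply: le_trans Hd _.
  by rewrite mulrAC ler_pdivrMr // -mulrA ler_wpM2l // ltW.
have cp : {within `[0, 1], continuous p}.
  apply: continuous_in_subspaceT => s; rewrite inE /= in_itv /= => /dp [ds _].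
  by apply: differentiable_continuous; apply/derivable1_diffP.
have [|c c01] := @MVT R p (fun s => g ('d f (z + cR s *: h) h)) 0 1 ltr01 _ cp.
  by move=> s; rewrite in_itv /= => /andP[s0 s1]; apply: dp; rewrite !ltW.
rewrite subr0 mulr1 /p cR1 cR0 scale1r scale0r addr0 => ->.
move: c01; rewrite in_itv /= => /andP[c0 c1].
by apply: (H c _).2; rewrite !ltW.
Qed.

(** The free constant [c] serves two purposes: c = 0 gives a Lipschitz bound, and c = ['d f z h] a
    second-order Taylor bound. *)
Lemma mean_value f z h (c : C) (B : R) :
  (forall s : R, 0 <= s <= 1 -> differentiable f (z + cR s *: h) /\
    nm ('d f (z + cR s *: h) h - c : C^o) <= B) ->
  nm (f (z + h) - f z - c : C^o) <= 2 * B.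
Proof.
move=> H; apply: le_trans (ler_nm_ReIm _) _; rewrite mulr_natl mulr2n; apply: lerD.
  rewrite !cReD !cReN; apply: mean_value_re.
  - exact: cReD.
  - exact: cReN.
  - by move=> k x; rewrite cReM cRe_cR cIm_cR mul0r subr0.
  - exact: ler_Re_nm.
  - move=> s /H [df dB]; split => //; rewrite -cReN -cReD.
    exact: le_trans (ler_Re_nm _) dB.
rewrite !cImD !cImN; apply: mean_value_re.
- exact: cImD.
- exact: cImN.
- by move=> k x; rewrite cImM cRe_cR cIm_cR mul0r addr0.
- exact: ler_Im_nm.
- move=> s /H [df dB]; split => //; rewrite -cImN -cImD.
  exact: le_trans (ler_Im_nm _) dB.
Qed.

(** At w = 0 the value is the junk 0 and not the derivative; [circ_mean] never looks there. *)
Definition slope f z u (w : C) : C := w^-1 * (f (z + w *: u) - f z).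

Lemma differentiable_slope f z u (w : C) : w != 0 ->
  differentiable f (z + w *: u) ->
  differentiable (slope f z u : C^o -> C^o) w.
Proof.
move=> w0 df.
have dline : differentiable (fun w : C^o => z + w *: u) w.
  apply: (@differentiableD C C^o V (cst z) (fun w : C^o => w *: u) w).
    exact: differentiable_cst.
  by apply: (@differentiableZl C C^o V (fun w => w) u w); exact: ex_diff.
have d1 : differentiable (fun w : C^o => f (z + w *: u) - f z : C^o) w.
  apply: (@differentiableB C C^o C^o (fun w : C^o => f (z + w *: u)) (cst (f z)) w);
    last exact: differentiable_cst.
  change (differentiable (f \o (fun w : C^o => z + w *: u)) w).
  exact: differentiable_comp.
have d2 : differentiable (fun w : C^o => w^-1 : C^o) w.
  exact: (@differentiable_Rinv C w).
exact: (@differentiableM C C^o (fun w : C^o => w^-1) (fun w : C^o => f (z + w *: u) - f z) w d2 d1).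
Qed.

(* Cauchy's formula with the constant [f z] subtracted, so that the integrand
   extends continuously to the centre with value ['d f z u]. *)
Lemma diff_circ f z u (rho r : R) : 0 < r -> r < rho ->
  (forall w : C, nm (w : C^o) < rho -> differentiable f (z + w *: u)) ->
  circ r (slope f z u) = cR (twopi R) * 'd f z u.
Proof.
move=> r0 rrho df; apply: (circ_mean r0 rrho).
  by move=> w w0 /df; apply: differentiable_slope.
have dfz : differentiable f z.
  by have := df 0; rewrite nm0 scale0r addr0; apply; exact: lt_trans rrho.
move=> e e0; have u1 : 0 < 1 + nm u by rewrite ltr_pwDl ?nm_ge0.
have [d d0 dP] := differentiable_nm dfz (divr_gt0 e0 u1).
exists (d / (1 + nm u)); first exact: divr_gt0.
move=> w w0 wd.
have wu : nm (w *: u) <= nm (w : C^o) * (1 + nm u).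
  by rewrite nmZ ler_wpM2l ?nm_ge0 // lerDr.
have wud : nm (w *: u) < d by apply: le_lt_trans wu _; rewrite -ltr_pdivlMr.
have := dP _ wud => Hd.
have nw : 0 < nm (w : C^o).
  by rewrite lt_neqAle nm_ge0 andbT eq_sym; apply/eqP => /nm_eq0; apply/eqP.
rewrite (_ : slope f z u w - _ = w^-1 * (f (z + w *: u) - f z - 'd f z (w *: u))).
  rewrite nmM nmV mulrC ler_pdivrMr //; apply: le_trans Hd _.
  by rewrite mulrAC ler_pdivrMr // -mulrA ler_wpM2l // ltW.
have -> : 'd f z (w *: u) = w * 'd f z u by rewrite linearZ.
by rewrite /slope [RHS]mulrBr mulKf.
Qed.

End SecondDerivative.

(** * Cauchy estimates for the first differential, and its differentiability *)

Section LocalSecondDerivative.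
Variables (R : realType) (V : normedModType (Cplx R)).
Local Notation C := (Cplx R).
Variables (f : V -> C^o) (z0 : V) (rho M : R).
Hypothesis rho0 : 0 < rho.
Hypothesis fM : forall w, nm (w - z0) < 4 * rho -> differentiable f w /\ nm (f w) <= M.
Implicit Types (z u h : V).

(** Only continuity of [g] is asked: the lemma is also applied to ['d f _ h], before that map is
    known to be differentiable. *)
Lemma cts_slope (g : V -> C^o) z u (w : C) : w != 0 ->
  {for z + w *: u, continuous g} ->
  {for w, continuous (slope g z u : C -> C)}.
Proof.
move=> w0 cg.
have cl : {for w, continuous (fun w : C => z + w *: u)}.
  apply: (@continuousD C V C (cst z) (fun w : C => w *: u) w).
    exact: cst_continuous.
  exact: (@scalel_continuous C V u).
have c1 : {for w, continuous (fun w : C => g (z + w *: u) - g z : C^o)}.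
  apply: (@continuousB C C^o C (fun w : C => g (z + w *: u)) (cst (g z)) w).
    exact: (@continuous_comp _ _ _ (fun w : C => z + w *: u) g).
  exact: cst_continuous.
have c2 : {for w, continuous (fun w : C => w^-1)} by exact: inv_continuous.
exact: (@continuousM C C (fun w : C => w^-1) (fun w : C => g (z + w *: u) - g z) w c2 c1).
Qed.

Lemma circ_le r (F : C -> C) (x : C) B : 0 <= r -> cts_circ r F ->
  circ r F = cR (twopi R) * x -> (forall w : C, nm (w : C^o) = r -> nm (F w : C^o) <= B) ->
  nm (x : C^o) <= 2 * B.
Proof.
move=> r0 cF Fx FB; have := circ_bound r0 cF FB.
rewrite Fx nmM nmR gtr0_norm ?twopi_gt0 // mulrA mulrC ler_pM2r //.
exact: twopi_gt0.
Qed.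

(** On the circle of radius [rad u] the displacement w u has norm rho / 2, so each use of Cauchy's
    formula stays within one rho. The radii thus decrease: f is bounded up to 4 rho, its
    differential is bounded up to 3 rho, Lipschitz up to 2 rho and differentiable up to rho. *)
Let rad u := rho / (2 * nm u).

Lemma rad_gt0 u : 0 < nm u -> 0 < rad u.
Proof. by move=> u0; rewrite divr_gt0 // mulr_gt0. Qed.

Lemma nm_rad u (w : C) : 0 < nm u -> nm (w : C^o) = rad u -> nm (w *: u) = rho / 2.
Proof. by move=> u0 wr; rewrite nmZ wr /rad; field; rewrite gt_eqF. Qed.

Lemma rad_neq0 u (w : C) : 0 < nm u -> nm (w : C^o) = rad u -> w != 0.
Proof.
move=> u0 wr; apply/eqP => w0; have := rad_gt0 u0.
by rewrite -wr w0 nm0 ltxx.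
Qed.

Lemma nm_shift z v d e : nm (z - z0) < d -> nm v <= e -> nm (z + v - z0) < d + e.
Proof.
move=> zd ve; rewrite addrAC; apply: le_lt_trans (nmD _ _) _.
by apply: ltr_leD.
Qed.

Lemma nm_V_rad u (w : C) : 0 < nm u -> nm (w : C^o) = rad u ->
  nm (w^-1 : C^o) = 2 * nm u / rho.
Proof. by move=> u0 wr; rewrite nmV wr /rad invf_div. Qed.

Section Representation.
Variables (z u : V).
Hypothesis (zr : nm (z - z0) < 3 * rho) (u0 : 0 < nm u).

Lemma diff_circ_rad : circ (rad u) (slope f z u) = cR (twopi R) * 'd f z u.
Proof.
have u2 : rad u < rho / nm u.
  rewrite /rad invfM mulrA ltr_pM2r ?invr_gt0 //; move: rho0; lra.
apply: (diff_circ (rad_gt0 u0) u2) => w wr.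
have wu : nm (w *: u) <= rho by rewrite nmZ -ler_pdivlMr // ltW.
have := nm_shift zr wu; rewrite (_ : 3 * rho + rho = 4 * rho); last by ring.
by case/fM.
Qed.

Lemma cts_slope_rad : cts_circ (rad u) (slope f z u).
Proof.
move=> w wr; apply: cts_slope (rad_neq0 u0 wr) _.
apply: differentiable_continuous.
have wu : nm (w *: u) <= rho by rewrite (nm_rad u0 wr); move: rho0; lra.
have := nm_shift zr wu; rewrite (_ : 3 * rho + rho = 4 * rho); last by ring.
by case/fM.
Qed.

End Representation.

(** The product of 2 from [circ_le], 2 / rho from the inverse of w, and 2 M from the difference of
    two values of f. *)
Let K := 8 * M / rho.

Lemma diff_bound z u : nm (z - z0) < 3 * rho -> nm ('d f z u : C^o) <= K * nm u.
Proof.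
move=> zr.
have [u0|un0] := eqVneq (nm u) 0.
  by rewrite u0 mulr0 (nm_eq0 u0) linear0 nm0.
have u0 : 0 < nm u by rewrite lt_neqAle eq_sym un0 nm_ge0.
have -> : K * nm u = 2 * (2 * nm u / rho * (2 * M)).
  by rewrite /K; field; rewrite gt_eqF.
apply: (circ_le (ltW (rad_gt0 u0)) (cts_slope_rad zr u0) (diff_circ_rad zr u0)).
move=> w wr; rewrite /slope nmM (nm_V_rad u0 wr).
apply: ler_wpM2l; first by rewrite divr_ge0 ?mulr_ge0 ?nm_ge0 // ltW.
apply: le_trans (nmB _ _) _; rewrite mulr_natl mulr2n; apply: lerD.
  have wu : nm (w *: u) <= rho by rewrite (nm_rad u0 wr); move: rho0; lra.
  have := nm_shift zr wu; rewrite (_ : 3 * rho + rho = 4 * rho); last by ring.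
  by case/fM.
by have [] := fM (lt_trans zr _); rewrite // ltr_pM2r // ltr_nat.
Qed.

Lemma nm_segment z h d (s : R) : 0 <= s <= 1 ->
  nm (z - z0) < d -> nm (z + h - z0) < d -> nm (z + cR s *: h - z0) < d.
Proof.
move=> /andP[s0 s1] zd zhd.
have -> : z + cR s *: h - z0 = cR (1 - s) *: (z - z0) + cR s *: (z + h - z0).
  have -> : z + h - z0 = (z - z0) + h by rewrite addrAC.
  by rewrite [cR s *: (_ + _)]scalerDr addrA -scalerDl -cRD subrK cR1 scale1r addrAC.
apply: le_lt_trans (nmD _ _) _; rewrite !nmZ !nmR !ger0_norm ?subr_ge0 //.
have [->|sn1] := eqVneq s 1; first by rewrite subrr mul0r add0r mul1r.
have -> : d = (1 - s) * d + s * d by ring.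
apply: ltr_leD; last by rewrite ler_wpM2l // ltW.
by rewrite ltr_pM2l // subr_gt0 lt_neqAle sn1.
Qed.

Lemma f_lip z w : nm (z - z0) < 3 * rho -> nm (w - z0) < 3 * rho ->
  nm (f w - f z : C^o) <= 2 * K * nm (w - z).
Proof.
move=> zr wr; have := @mean_value R V f z (w - z) 0 (K * nm (w - z)).
rewrite subr0 subrKC mulrA; apply => s s01.
have zs : nm (z + cR s *: (w - z) - z0) < 3 * rho.
  by apply: nm_segment => //; rewrite subrKC.
split; last by rewrite subr0 diff_bound.
by have [] := fM (lt_trans zs _); rewrite // ltr_pM2r // ltr_nat.
Qed.

(** As for [K], with two Lipschitz increments of constant 2 K in place of the two values of f. *)
Let K2 := 16 * K / rho.

(** Subtracting Cauchy's formulas at w and z, the numerators regroup into increments of f between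
    translates of z and w, to which [f_lip] applies. *)
Lemma diff_lip z w u : nm (z - z0) < 2 * rho -> nm (w - z0) < 2 * rho ->
  nm ('d f w u - 'd f z u : C^o) <= K2 * nm (w - z) * nm u.
Proof.
move=> zr wr.
have [u0|un0] := eqVneq (nm u) 0.
  by rewrite u0 mulr0 (nm_eq0 u0) !linear0 addr0 nm0.
have u0 : 0 < nm u by rewrite lt_neqAle eq_sym un0 nm_ge0.
have r23 : 2 * rho < 3 * rho by rewrite ltr_pM2r // ltr_nat.
have -> : K2 * nm (w - z) * nm u =
    2 * (2 * nm u / rho * (2 * K * nm (w - z) + 2 * K * nm (w - z))).
  by rewrite /K2; field; rewrite gt_eqF.
have zr3 := lt_trans zr r23; have wr3 := lt_trans wr r23.
have cw := cts_slope_rad wr3 u0; have cz := cts_slope_rad zr3 u0.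
apply: (@circ_le (rad u) (fun t => slope f w u t - slope f z u t)).
- exact: ltW (rad_gt0 u0).
- by move=> t tr; exact: (@continuousB C C^o C _ _ t (cw t tr) (cz t tr)).
- by rewrite (circB (ltW (rad_gt0 u0)) cw cz) !diff_circ_rad // mulrBr.
move=> t tr.
have -> : slope f w u t - slope f z u t =
    t^-1 * ((f (w + t *: u) - f (z + t *: u)) - (f w - f z)).
  by rewrite /slope; ring.
rewrite nmM (nm_V_rad u0 tr).
apply: ler_wpM2l; first by rewrite divr_ge0 ?mulr_ge0 ?nm_ge0 // ltW.
have tu : nm (t *: u) <= rho by rewrite (nm_rad u0 tr); move: rho0; lra.
have e3 : 2 * rho + rho = 3 * rho by ring.
apply: le_trans (nmB _ _) _; apply: lerD; last exact: f_lip.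
have -> : w - z = (w + t *: u) - (z + t *: u) by rewrite opprD addrACA subrr addr0.
by apply: f_lip; rewrite -e3; apply: nm_shift.
Qed.

Lemma diff_cts z u : nm (z - z0) < 2 * rho -> {for z, continuous (fun w => 'd f w u)}.
Proof.
move=> zr P /(@nbhs_nmP R C^o)[e e0 eP].
(* No sign is assumed on [M], hence the absolute value; the 1 makes the divisor positive. *)
have k0 : 0 < 1 + `|K2| * nm u by rewrite ltr_pwDl // mulr_ge0 // nm_ge0.
apply/nbhs_nmP; exists (Num.min (2 * rho - nm (z - z0)) (e / (1 + `|K2| * nm u))).
  by rewrite lt_min subr_gt0 zr divr_gt0.
move=> h; rewrite lt_min => /andP[h1 h2].
change (P ('d f (z + h) u)).
have -> : 'd f (z + h) u = 'd f z u + ('d f (z + h) u - 'd f z u).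
  by rewrite [RHS]addrC subrK.
apply: eP; apply: le_lt_trans (diff_lip _ zr _) _.
  by rewrite addrAC; apply: le_lt_trans (nmD _ _) _; rewrite -ltrBrDl.
rewrite [z + h]addrC addrK mulrAC.
apply: le_lt_trans (_ : (1 + `|K2| * nm u) * nm h < e).
  apply: ler_wpM2r; first exact: nm_ge0.
  by apply: ler_wpDl => //; apply: ler_wpM2r; [exact: nm_ge0|exact: ler_norm].
by rewrite mulrC -ltr_pdivlMr.
Qed.

Lemma taylor z h : nm (z - z0) < 2 * rho -> nm (z + h - z0) < 2 * rho ->
  nm (f (z + h) - f z - 'd f z h : C^o) <= 2 * (K2 * nm h * nm h).
Proof.
move=> zr zhr; apply: mean_value => s s01.
have zs := nm_segment s01 zr zhr.
split; first by have [] := fM (lt_trans zs _); rewrite // ltr_pM2r // ltr_nat.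
apply: le_trans (diff_lip _ zr zs) _.
rewrite [z + _]addrC addrK ler_wpM2r ?nm_ge0 //.
(* The sign of [K2] is read off from [diff_lip], where a multiple of it bounds a norm; this needs h
   nonzero. *)
have K20 : 0 <= K2 * nm h * nm h.
  have := diff_lip h zr zhr; rewrite (_ : z + h - z = h); last by rewrite addrC addKr.
  by apply: le_trans; exact: nm_ge0.
have [h0|hn0] := eqVneq (nm h) 0; first by rewrite nmZ h0 !mulr0.
have {}h0 : 0 < nm h by rewrite lt_neqAle eq_sym hn0 nm_ge0.
have K2_ge0 : 0 <= K2 by move: K20; rewrite -mulrA pmulr_lge0 // mulr_gt0.
rewrite ler_wpM2l // nmZ nmR; move/andP: s01 => [s0 s1].
by rewrite ger0_norm // ler_piMl ?nm_ge0.
Qed.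

(* The right-hand side is also Cauchy's formula at [z] for ['d f _ h], once that
   function is known to be differentiable: hence the symmetry of the second
   differential. *)
Lemma second_diff z u : 0 < nm u -> nm (z - z0) < rho ->
  differentiable (fun w => 'd f w u : C^o) z /\
  forall h, cR (twopi R) * 'd (fun w => 'd f w u : C^o) z h =
            circ (rad u) (slope (fun w => 'd f w h : C^o) z u).
Proof.
move=> u0 zr.
have r0 := rad_gt0 u0; have r0' := ltW r0.
have r12 : rho < 2 * rho by rewrite ltr_pMl // ltr1n.
have r23 : 2 * rho < 3 * rho by rewrite ltr_pM2r // ltr_nat.
have e2 : rho + rho / 2 < 2 * rho by move: rho0; lra.
have zr2 := lt_trans zr r12; have zr3 := lt_trans zr2 r23.
pose D h : V -> C^o := fun w => 'd f w h.
have wr2 (w : C) : nm (w : C^o) = rad u -> nm (z + w *: u - z0) < 2 * rho.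
  move=> wr; apply: lt_trans (_ : rho + rho / 2 < _) => //.
  by apply: nm_shift => //; rewrite (nm_rad u0 wr).
have cD h : cts_circ (rad u) (slope (D h) z u).
  by move=> w wr; apply: cts_slope (rad_neq0 u0 wr) _; apply: diff_cts; apply: wr2.
have p0 : cR (twopi R) != 0 :> C.
  by apply/eqP => p0; have := twopi_gt0 R; rewrite -(cRe_cR (twopi R)) p0 ltxx.
(* Cauchy's formula for ['d f z u], differentiated in z along h under the integral sign. *)
pose T h : C^o := (cR (twopi R))^-1 * circ (rad u) (slope (D h) z u).
have TE h : circ (rad u) (slope (D h) z u) = cR (twopi R) * T h.
  by rewrite /T mulVKf.
have Tlin : linear T.
  move=> k h h'; apply: (mulfI p0); rewrite -TE.
  rewrite [RHS]mulrDr -TE -[k *: T h]/(k * T h) mulrCA -TE -(circZ k r0' (cD h)).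
  have ck : cts_circ (rad u) (fun w => k * slope (D h) z u w).
    move=> w wr; apply: (@continuousM C C (cst k) (slope (D h) z u) w).
      exact: cst_continuous.
    exact: cD.
  rewrite -(circD r0' ck (cD h')); apply: eq_circ => // w _.
  by rewrite /slope /D !linearP /= -![k *: _]/(k * _); ring.
have TK h : nm (T h) <= 2 * (K2 * nm u) * nm h.
  rewrite -mulrA; apply: (circ_le r0' (cD h) (TE h)) => w wr.
  have nw : nm (w^-1 : C^o) * nm (w : C^o) = 1.
    by rewrite -nmM mulVf ?(rad_neq0 u0 wr) // nmR normr1.
  rewrite /slope nmM.
  have := diff_lip h zr2 (wr2 w wr); rewrite [z + _]addrC addrK nmZ.
  move=> /(ler_wpM2l (nm_ge0 (w^-1 : C^o))) /le_trans; apply.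
  rewrite (_ : nm _ * (K2 * (nm w * nm u) * nm h) =
    nm (w^-1 : C^o) * nm (w : C^o) * (K2 * nm u * nm h)); last by ring.
  by rewrite nw mul1r.
suff Tdiff e : 0 < e -> exists2 d : R, 0 < d & forall h, nm h < d ->
    nm (D u (z + h) - D u z - T h) <= e * nm h.
  have [dD dT] := nm_differentiable Tlin TK Tdiff.
  by split=> // h; rewrite TE dT.
move=> e0.
pose K3 := 2 * (2 * nm u / rho * (2 * K2 + 2 * K2)).
have k0 : 0 < 1 + `|K3| by rewrite ltr_pwDl.
exists (Num.min (rho / 2) (e / (1 + `|K3|))).
  by rewrite lt_min !divr_gt0.
move=> h; rewrite lt_min => /andP[h1 h2].
have zhr2 : nm (z + h - z0) < 2 * rho.
  by apply: lt_trans (nm_shift zr (ltW h1)) e2.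
have zhr3 := lt_trans zhr2 r23.
have wh2 (w : C) : nm (w : C^o) = rad u -> nm (z + w *: u + h - z0) < 2 * rho.
  move=> wr; have wu : nm (w *: u) <= rho / 2 by rewrite (nm_rad u0 wr).
  have := nm_shift (nm_shift zr wu) (ltW h1).
  by rewrite (_ : rho + rho / 2 + rho / 2 = 2 * rho) //; field.
have c1 := cts_slope_rad zhr3 u0; have c2 := cts_slope_rad zr3 u0.
have c12 : cts_circ (rad u) (fun w => slope f (z + h) u w - slope f z u w).
  by move=> w wr; exact: (@continuousB C C^o C _ _ w (c1 w wr) (c2 w wr)).
pose F w := slope f (z + h) u w - slope f z u w - slope (D h) z u w.
have cF : cts_circ (rad u) F.
  by move=> w wr; exact: (@continuousB C C^o C _ _ w (c12 w wr) (cD h w wr)).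
have FE : circ (rad u) F = cR (twopi R) * (D u (z + h) - D u z - T h).
  rewrite /F (circB r0' c12 (cD h)) (circB r0' c1 c2) TE !diff_circ_rad //.
  by rewrite !mulrBr.
apply: le_trans (_ : K3 * nm h * nm h <= _); last first.
  apply: ler_wpM2r; first exact: nm_ge0.
  move: h2; rewrite ltr_pdivlMr // mulrDr mulr1 => h2; apply: ltW; apply: le_lt_trans h2.
  rewrite mulrC -[leLHS]add0r; apply: lerD; first exact: nm_ge0.
  by apply: ler_wpM2l; [exact: nm_ge0|exact: ler_norm].
have -> : K3 * nm h * nm h = 2 * (2 * nm u / rho *
    (2 * (K2 * nm h * nm h) + 2 * (K2 * nm h * nm h))) by rewrite /K3; ring.
apply: (circ_le r0' cF FE) => w wr.
(* The integrand is a difference of two Taylor remainders with the same increment h, at z + w u and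
   at z. Each is quadratic in h, and [K3] gathers the constants. *)
have -> : F w = w^-1 * ((f (z + w *: u + h) - f (z + w *: u) - D h (z + w *: u))
    - (f (z + h) - f z - D h z)).
  by rewrite /F /slope (addrAC z h); ring.
rewrite nmM (nm_V_rad u0 wr).
apply: ler_wpM2l; first by rewrite divr_ge0 ?mulr_ge0 ?nm_ge0 // ltW.
by apply: le_trans (nmB _ _) _; apply: lerD; apply: taylor => //; [exact: wr2|exact: wh2].
Qed.

End LocalSecondDerivative.

Section NearEq.
Variables (R : realType) (V W : normedModType (Cplx R)).

(** Charts are inverse to each other only on open sets, so chart identities reach differentials
    through this lemma. *)
Lemma near_eq_differentiable (f g : V -> W) (z : V) :
  (\near z, f z = g z) -> differentiable f z ->
  differentiable g z /\ 'd g z = 'd f z :> (V -> W).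
Proof.
move=> fg df; have [K K0 KP] := diff_nm_bound df.
apply: (nm_differentiable (K := K)) => //; first exact: linearP.
move=> e e0; have [d1 d10 H1] := differentiable_nm df e0.
have /nbhs_nmP[d2 d20 H2] := fg.
exists (Num.min d1 d2); first by rewrite lt_min d10.
move=> h; rewrite lt_min => /andP[/H1 hd1 /H2 <-].
by rewrite -(nbhs_singleton fg).
Qed.

End NearEq.

(** * Coordinates of vector-valued maps and the product rule *)

Section Coordinates.
Variables (R : realType) (V : normedModType (Cplx R)).
Local Notation C := (Cplx R).

Lemma diff_coord m (f : V -> 'rV[C]_m) z j : differentiable f z ->
  differentiable (fun w => f w ord0 j : C^o) z /\
  forall v, 'd (fun w => f w ord0 j : C^o) z v = 'd f z v ord0 j.
Proof.
move=> df.
have cl : linear (fun x : 'rV[C]_m => x ord0 j : C^o).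
  by move=> k x y; rewrite !mxE.
pose cM := GRing.isLinear.Build _ _ _ _ _ cl.
pose L : {linear 'rV[C]_m -> C^o} := HB.pack (fun x : 'rV[C]_m => x ord0 j : C^o) cM.
have Lc : continuous L by exact: coord_continuous.
have dL := linear_differentiable (f z) Lc.
split; first by apply: (differentiable_comp df dL).
move=> v; have := diff_comp df dL; rewrite (diff_lin _ Lc) => H.
by have := congr1 (fun h : V -> C^o => h v) H.
Qed.

Lemma differentiable_row m (f : V -> 'rV[C]_m) z :
  (forall j, differentiable (fun w => f w ord0 j : C^o) z) -> differentiable f z.
Proof.
move=> df.
have -> : f = \sum_(j < m) (fun w => (f w ord0 j : C^o) *: delta_mx ord0 j).
  apply/funext => w; rewrite fct_sumE [LHS]row_sum_delta.
  by apply: eq_bigr.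
by apply: differentiable_sum => j; apply: differentiableZl.
Qed.

Lemma derive_sumM n (a b : 'I_n -> V -> C^o) z v :
  (forall j, differentiable (a j) z) -> (forall j, differentiable (b j) z) ->
  differentiable (fun w => \sum_(j < n) a j w * b j w : C^o) z /\
  'd (fun w => \sum_(j < n) a j w * b j w : C^o) z v =
  \sum_(j < n) (a j z * 'd (b j) z v + b j z * 'd (a j) z v).
Proof.
move=> da db.
have E : (fun w => \sum_(j < n) a j w * b j w : C^o) =
    \sum_(j < n) ((a j : V -> C) * (b j : V -> C)).
  by apply/funext => w; rewrite fct_sumE.
have dab : differentiable (fun w => \sum_(j < n) a j w * b j w : C^o) z.
  rewrite E; apply: (@differentiable_sum C V C^o) => j.
  exact: (@differentiableM C V (a j) (b j)).
split; first exact: dab.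
have da' j : derivable (a j : V -> C) z v by exact: diff_derivable (da j).
have db' j : derivable (b j : V -> C) z v by exact: diff_derivable (db j).
refine (etrans (esym (deriveE v dab)) _).
refine (etrans (congr1 (fun F : V -> C^o => 'D_v F z) E) _).
have dM j := @derivableM C V (a j) (b j) z v (da' j) (db' j).
refine (etrans (@derive_sum C V C^o n (fun j => (a j : V -> C) * (b j : V -> C)) z v dM) _).
apply: eq_bigr => j _.
refine (etrans (@deriveM C V (a j) (b j) z v (da' j) (db' j)) _).
by congr (_ * _ + _ * _); exact: deriveE.
Qed.

(** Product rule for a varying linear map applied to a varying vector. In finite dimension the
    linear map is given by its columns, so differentiability of [B^~ u] for each fixed u is
    enough. *)
Lemma diff_apply n m (B : V -> 'rV[C]_n -> 'rV[C]_m) (X : V -> 'rV[C]_n) z :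
  (forall w, linear (B w)) -> (forall u, differentiable (B^~ u) z) ->
  differentiable X z ->
  differentiable (fun w => B w (X w)) z /\
  forall v, 'd (fun w => B w (X w)) z v = 'd (B^~ (X z)) z v + B z ('d X z v).
Proof.
move=> Blin dB dX.
have BE w x i : B w x ord0 i = \sum_(j < n) x ord0 j * B w (delta_mx ord0 j) ord0 i.
  pose BM := GRing.isLinear.Build _ _ _ _ _ (Blin w).
  pose L : {linear 'rV[C]_n -> 'rV[C]_m} := HB.pack (B w) BM.
  rewrite -[B w]/(L : _ -> _) {1}(row_sum_delta x) linear_sum summxE.
  by apply: eq_bigr => j _; rewrite linearZ mxE.
have key (Y : V -> 'rV[C]_n) i v : differentiable Y z ->
    differentiable (fun w => B w (Y w) ord0 i : C^o) z /\
    'd (fun w => B w (Y w) ord0 i : C^o) z v = \sum_(j < n)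
      (Y z ord0 j * 'd (fun w => B w (delta_mx ord0 j) ord0 i : C^o) z v +
       B z (delta_mx ord0 j) ord0 i * 'd Y z v ord0 j).
  move=> dY.
  rewrite (_ : (fun w => B w (Y w) ord0 i : C^o) =
    (fun w => \sum_(j < n) Y w ord0 j * B w (delta_mx ord0 j) ord0 i : C^o)).
    have dA j := (diff_coord j dY).1.
    have dE j := (diff_coord i (dB (delta_mx ord0 j))).1.
    have [d1 d2] := @derive_sumM n (fun j w => Y w ord0 j)
      (fun j w => B w (delta_mx ord0 j) ord0 i) z v dA dE.
    split; first exact: d1.
    refine (etrans d2 _); apply: eq_bigr => j _.
    by congr (_ + _ * _); exact: (diff_coord j dY).2.
  by apply/funext => w; rewrite BE.
have dBX : differentiable (fun w => B w (X w)) z.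
  by apply: differentiable_row => i; have [] := key X i 0 dX.
split => // v; apply/rowP => i; rewrite mxE.
refine (etrans (esym ((diff_coord i dBX).2 v)) _).
refine (etrans (key X i v dX).2 _).
(* The same expansion with [X] frozen identifies the terms where only [B] is differentiated. *)
have K := (key (cst (X z)) i v (differentiable_cst _ _)).2.
have K' := etrans (esym ((diff_coord i (dB (X z))).2 v)) K.
refine (etrans _ (congr1 (fun t => t + B z ('d X z v) ord0 i) (esym K'))).
rewrite BE -big_split /=; apply: eq_bigr => j _.
have c0 : 'd (cst (X z) : V -> 'rV[C]_n) z v = 0.
  exact: (congr1 (fun F : V -> 'rV[C]_n => F v) (diff_cst (X z) z)).
have E0 t : t * ('d (cst (X z) : V -> 'rV[C]_n) z v) ord0 j = 0.
  by rewrite c0 mxE mulr0.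
refine (etrans _ (congr1 (fun t => _ + t + _) (esym (E0 _)))).
by rewrite addr0; congr (_ + _); exact: mulrC.
Qed.

End Coordinates.

(** * Second differentials of maps differentiable near a point *)

Section HolomorphicDifferential.
Variables (R : realType) (V : normedModType (Cplx R)).
Local Notation C := (Cplx R).

Lemma second_diff_near (f : V -> C^o) z : (\forall w \near z, differentiable f w) ->
  (forall u, differentiable (fun w => 'd f w u : C^o) z) /\
  forall u h, 'd (fun w => 'd f w u : C^o) z h = 'd (fun w => 'd f w h : C^o) z u.
Proof.
move=> df.
have cf : {for z, continuous f}.
  by apply: differentiable_continuous; exact: nbhs_singleton df.
have bf : \forall w \near z, nm (f w) <= 1 + nm (f z).
  have N : nbhs (f z) [set y : C^o | nm (y - f z) < 1].
    apply/nbhs_nmP; exists 1 => // h h1 /=.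
    by rewrite [f z + h]addrC addrK.
  have N' : nbhs z (f @^-1` [set y : C^o | nm (y - f z) < 1]) by exact: cf.
  apply: filterS N' => w /= w1.
  have := nmD (f w - f z) (f z); rewrite subrK => /le_trans; apply.
  by rewrite lerD2r ltW.
have [d d0 dP] := (nbhs_nmP _ _).1 (filterI df bf).
pose rho := d / 4.
have rho0 : 0 < rho by rewrite divr_gt0.
have fM w : nm (w - z) < 4 * rho -> differentiable f w /\ nm (f w) <= 1 + nm (f z).
  move=> wd; rewrite -(subrKC z w); apply: dP.
  by move: wd; rewrite /rho mulrC divfK // pnatr_eq0.
have d0E : (fun w => 'd f w 0 : C^o) = cst 0 by apply/funext => w; rewrite linear0.
(* The radius of Cauchy's circle divides by the norm of the direction, so zero directions, where
   both sides vanish, are set apart. *)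
have pos (v : V) : v = 0 \/ 0 < nm v.
  have [/nm_eq0|v0] := eqVneq (nm v) 0; first by left.
  by right; rewrite lt_neqAle eq_sym v0 nm_ge0.
have dD w u : nm (w - z) < rho -> differentiable (fun w => 'd f w u : C^o) w.
  move=> wr; have [->|u0] := pos u.
    by rewrite d0E; exact: differentiable_cst.
  by have [] := second_diff rho0 fM u0 wr.
have zz : nm (z - z) < rho by rewrite subrr nm0.
split; first by move=> u; apply: dD.
move=> u h.
have zero v : 'd (fun w => 'd f w 0 : C^o) z v = 'd (fun w => 'd f w v : C^o) z 0.
  refine (etrans (congr1 (fun F : V -> C^o => 'd F z v) d0E) _).
  refine (etrans (congr1 (fun F : V -> C^o => F v) (diff_cst (0 : C^o) z)) _).
  by symmetry; exact: linear0.
have [->|u0] := pos u; first exact: zero.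
have [->|h0] := pos h; first by symmetry; exact: zero.
have [_ /(_ h) H] := second_diff rho0 fM u0 zz.
have p0 : cR (twopi R) != 0 :> C.
  by apply/eqP => p0; have := twopi_gt0 R; rewrite -(cRe_cR (twopi R)) p0 ltxx.
apply: (mulfI p0); rewrite H.
apply: (@diff_circ _ _ _ _ _ (rho / nm u)).
- by rewrite divr_gt0 // mulr_gt0.
- by rewrite invfM mulrA ltr_pM2r ?invr_gt0 //; move: rho0; lra.
move=> w; rewrite (ltr_pdivlMr _ _ u0) => wu.
have wz : nm (z + w *: u - z) < rho by rewrite addrC addKr nmZ.
exact: (dD _ h wz).
Qed.

(** The domain is left general: it will be V for transition maps and translations, V * V for
    products and quotients in the group, and the scalars for curves. *)
Lemma second_diff_row m (f : V -> 'rV[C]_m) z :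
  (\forall w \near z, differentiable f w) ->
  (forall u, differentiable (fun w => 'd f w u) z) /\
  forall u h, 'd (fun w => 'd f w u) z h = 'd (fun w => 'd f w h) z u.
Proof.
move=> df.
have df_ j : \forall w \near z, differentiable (fun w => f w ord0 j : C^o) w.
  by apply: filterS df => w /(diff_coord j)[].
have E j u : \near z, 'd (fun w => f w ord0 j : C^o) z u = 'd f z u ord0 j :> C^o.
  by apply: filterS df => w /(diff_coord j)[_ ->].
have H j u := near_eq_differentiable (E j u) ((second_diff_near (df_ j)).1 u).
have dd u : differentiable (fun w => 'd f w u) z.
  by apply: differentiable_row => j; case: (H j u).
split => // u h; apply/rowP => j.
refine (etrans (esym ((diff_coord j (dd u)).2 h)) _).
refine (etrans _ ((diff_coord j (dd h)).2 u)).
refine (etrans (congr1 (fun F : V -> C^o => F h) (H j u).2) _).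
refine (etrans _ (congr1 (fun F : V -> C^o => F u) (esym (H j h).2))).
exact: (second_diff_near (df_ j)).2.
Qed.

End HolomorphicDifferential.

(** * Calculus in charts *)

Section ChartCalculus.
Variables (R : realType) (n : nat) (M : topologicalType).
Local Notation C := (Cplx R).
Local Notation V := 'rV[C]_n.
Implicit Types (phi psi chi : chart R n M) (p : M).

Lemma chart_near phi p (U : set M) : chart_dom phi p -> nbhs p U ->
  \forall z \near chart_map phi p,
    [/\ U (chart_inv phi z), chart_dom phi (chart_inv phi z) &
        chart_map phi (chart_inv phi z) = z].
Proof.
move=> pd pU.
have im : nbhs (chart_map phi p) (chart_map phi @` chart_dom phi).
  by apply: open_nbhs_nbhs; split; [exact: chart_img_open|exists p].
have ci : nbhs (chart_map phi p) (chart_inv phi @^-1` U).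
  apply: (chart_inv_cts (c := phi)); first by exists p.
  by rewrite chart_mapK.
by apply: filterS2 im ci => z [p' p'd <-]; rewrite /= chart_mapK.
Qed.

Lemma chart_dom_nbhs phi p : chart_dom phi p -> nbhs p (chart_dom phi).
Proof. by move=> pd; apply: open_nbhs_nbhs; split => //; exact: chart_dom_open. Qed.

Lemma chart_inv_cvg phi p : chart_dom phi p ->
  {for chart_map phi p, continuous (chart_inv phi)}.
Proof. by move=> pd; apply: chart_inv_cts; exists p. Qed.

(** Chain rule with a manifold in the middle: inserting [chart_inv psi] after [chart_map psi]
    changes nothing near [a]. *)
Lemma diff_through_chart (N W : normedModType C) (a : N) (h : N -> M) (F : M -> W) psi :
  {for a, continuous h} -> chart_dom psi (h a) ->
  differentiable (chart_map psi \o h) a ->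
  differentiable (F \o chart_inv psi) (chart_map psi (h a)) ->
  differentiable (F \o h) a /\ forall v,
    'd (F \o h) a v = 'd (F \o chart_inv psi) (chart_map psi (h a)) ('d (chart_map psi \o h) a v).
Proof.
move=> ch hd dh dF.
have dc : differentiable ((F \o chart_inv psi) \o (chart_map psi \o h)) a.
  exact: differentiable_comp.
have E : \near a, ((F \o chart_inv psi) \o (chart_map psi \o h)) a = (F \o h) a.
  have N' : nbhs a (h @^-1` chart_dom psi) by exact: ch _ (chart_dom_nbhs hd).
  apply: filterS N' => x /= xd.
  by rewrite chart_mapK.
have [d1 d2] := near_eq_differentiable E dc.
split; first exact: d1.
move=> v; refine (etrans (congr1 (fun T : N -> W => T v) d2) _).
exact: (congr1 (fun T : N -> W => T v) (diff_comp dh dF)).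
Qed.

End ChartCalculus.

Section ManifoldCalculus.
Variables (R : realType) (n : nat) (M : topologicalType).
Local Notation C := (Cplx R).
Local Notation V := 'rV[C]_n.
Variable S : complex_manifold R n M.
Implicit Types (phi psi chi : chart R n M) (p : M) (u v : V).
Local Notation E := (chart_at S).

Lemma transition_hol_near phi psi p : atlas S phi -> atlas S psi ->
  chart_dom phi p -> chart_dom psi p ->
  \forall z \near chart_map phi p, differentiable (chart_map psi \o chart_inv phi) z.
Proof.
move=> aphi apsi pphi ppsi.
have := chart_near pphi (chart_dom_nbhs ppsi).
apply: filterS => z [z1 z2 z3]; rewrite -z3.
exact: (transition_hol aphi apsi).
Qed.

Lemma diff_chart_id phi p : chart_dom phi p ->
  differentiable (chart_map phi \o chart_inv phi) (chart_map phi p) /\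
  forall v, 'd (chart_map phi \o chart_inv phi) (chart_map phi p) v = v.
Proof.
move=> pd.
have Eid : \forall z \near chart_map phi p, (id : V -> V) z =
    (chart_map phi \o chart_inv phi) z.
  by apply: filterS (chart_near pd filterT) => z /= [_ _ ->].
have did : differentiable (id : V -> V) (chart_map phi p) by exact: ex_diff.
have [d1 d2] := near_eq_differentiable Eid did.
split; first exact: d1.
move=> v; refine (etrans (congr1 (fun T : V -> V => T v) d2) _).
have did' : 'd (id : V -> V) (chart_map phi p) = id :> (V -> V) by exact: diff_val.
exact: (congr1 (fun T : V -> V => T v) did').
Qed.

Lemma to_chart_lin phi p : linear (to_chart S phi p).
Proof. by move=> a u v; rewrite /to_chart linearP. Qed.

Lemma of_chart_lin phi p : linear (of_chart S phi p).
Proof. by move=> a u v; rewrite /of_chart linearP. Qed.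

Lemma to_chart_id p v : to_chart S (E p) p v = v.
Proof. exact: (diff_chart_id (chart_at_dom S p)).2. Qed.

Lemma of_chart_id p v : of_chart S (E p) p v = v.
Proof. exact: (diff_chart_id (chart_at_dom S p)).2. Qed.

Lemma transition_comp phi psi chi p v : atlas S phi -> atlas S psi -> atlas S chi ->
  chart_dom phi p -> chart_dom psi p -> chart_dom chi p ->
  'd (chart_map chi \o chart_inv phi) (chart_map phi p) v =
  'd (chart_map chi \o chart_inv psi) (chart_map psi p)
    ('d (chart_map psi \o chart_inv phi) (chart_map phi p) v).
Proof.
move=> a1 a2 a3 d1 d2 d3.
have pE := chart_mapK d1.
have [||||_ H] := @diff_through_chart R n M V V (chart_map phi p) (chart_inv phi)
  (chart_map chi) psi.
- exact: chart_inv_cvg.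
- by rewrite pE.
- exact: (transition_hol a1 a2).
- by rewrite pE; exact: (transition_hol a2 a3).
by move: (H v); rewrite pE.
Qed.

Lemma of_to_chart phi p v : atlas S phi -> chart_dom phi p ->
  of_chart S phi p (to_chart S phi p v) = v.
Proof.
move=> a d; have aE := chart_at_atlas S p; have dE := chart_at_dom S p.
refine (etrans _ ((diff_chart_id dE).2 v)).
exact: esym (transition_comp v aE a aE dE d dE).
Qed.

Definition hol_at (f : M -> M) p := {for p, continuous f} /\
  forall phi psi, atlas S phi -> atlas S psi -> chart_dom phi p ->
    chart_dom psi (f p) ->
    differentiable (chart_map psi \o f \o chart_inv phi) (chart_map phi p).

(** Both sides differentiate the same map, [chart_map psi] after f after the inverse of the
    preferred chart at p, factored once through the preferred chart at f p and once through
    [phi]. *)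
Lemma to_chart_mdiff f phi psi p v : hol_at f p -> atlas S phi -> atlas S psi ->
  chart_dom phi p -> chart_dom psi (f p) ->
  to_chart S psi (f p) (mdiff S f p v) =
  'd (chart_map psi \o f \o chart_inv phi) (chart_map phi p) (to_chart S phi p v).
Proof.
move=> [cf hf] a1 a2 d1 d2.
have aE := chart_at_atlas S p; have dE := chart_at_dom S p.
have aF := chart_at_atlas S (f p); have dF := chart_at_dom S (f p).
have pE := chart_mapK dE.
have c1 := chart_inv_cvg dE.
have [|||| _ H1] := @diff_through_chart R n M V V (chart_map (E p) p) (f \o chart_inv (E p))
  (chart_map psi) (E (f p)).
- by apply: continuous_comp c1 _; rewrite pE.
- by rewrite /= pE.
- exact: (hf _ _ aE aF).
- by rewrite /= pE; exact: (transition_hol aF a2).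
have [|||| _ H2] := @diff_through_chart R n M V V (chart_map (E p) p) (chart_inv (E p))
  (chart_map psi \o f) phi.
- exact: c1.
- by rewrite pE.
- exact: (transition_hol aE a1).
- by rewrite pE; exact: (hf _ _ a1 a2).
move: (H1 v) (H2 v); rewrite /= pE => {}H1 {}H2.
exact: etrans (esym H1) H2.
Qed.

Lemma mdiff_comp f g p v : hol_at f p -> hol_at g (f p) ->
  mdiff S g (f p) (mdiff S f p v) = mdiff S (g \o f) p v.
Proof.
move=> [cf hf] [cg hg].
have aE := chart_at_atlas S p; have dE := chart_at_dom S p.
have aF := chart_at_atlas S (f p); have dF := chart_at_dom S (f p).
have aG := chart_at_atlas S (g (f p)); have dG := chart_at_dom S (g (f p)).
have pE := chart_mapK dE.
have [|||| _ H1] := @diff_through_chart R n M V V (chart_map (E p) p) (f \o chart_inv (E p))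
  (chart_map (E (g (f p))) \o g) (E (f p)).
- by apply: (continuous_comp (chart_inv_cvg dE)); rewrite pE.
- by rewrite /= pE.
- exact: (hf _ _ aE aF).
- by rewrite /= pE; exact: (hg _ _ aF aG).
by move: (H1 v); rewrite /= pE => {}H1; exact: esym H1.
Qed.

End ManifoldCalculus.

(** * Left-invariant fields and curves in a Lie group *)

Section Pairs.
Variables (R : realType) (V1 V2 W : normedModType (Cplx R)).

Lemma diff_snd_slot (F : V1 * V2 -> W) a b : differentiable F (a, b) ->
  differentiable (fun w => F (a, w)) b /\
  forall v, 'd (fun w => F (a, w)) b v = 'd F (a, b) (0, v).
Proof.
move=> dF.
have dp : is_diff b (fun w : V2 => (cst a w, id w)) (fun v : V2 => ((0 : V2 -> V1) v, id v)).
  exact: is_diff_pair.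
case: dp => dp dpE.
split; first exact: (differentiable_comp dp dF).
move=> v; refine (etrans (congr1 (fun T : V2 -> W => T v) (diff_comp dp dF)) _).
by congr ('d F (a, b) _); exact: (congr1 (fun T : V2 -> V1 * V2 => T v) dpE).
Qed.

Lemma differentiable_pair_cst (a : V1) (b : V2) :
  differentiable (fun z : V1 => (z, b)) a.
Proof.
have dp : is_diff a (fun z : V1 => (id z, cst b z)) (fun v : V1 => (id v, (0 : V1 -> V2) v)).
  exact: is_diff_pair.
by case: dp.
Qed.

Lemma differentiable_fst (z : V1 * V2) : differentiable (fun z : V1 * V2 => z.1) z.
Proof.
have l : linear (fun z : V1 * V2 => z.1) by [].
pose lM := GRing.isLinear.Build _ _ _ _ _ l.
pose F : {linear (V1 * V2)%type -> V1} := HB.pack (fun z : V1 * V2 => z.1) lM.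
have Fc : continuous F by move=> y; exact: cvg_fst.
exact: (linear_differentiable z Fc).
Qed.

Lemma differentiable_snd (z : V1 * V2) : differentiable (fun z : V1 * V2 => z.2) z.
Proof.
have l : linear (fun z : V1 * V2 => z.2) by [].
pose lM := GRing.isLinear.Build _ _ _ _ _ l.
pose F : {linear (V1 * V2)%type -> V2} := HB.pack (fun z : V1 * V2 => z.2) lM.
have Fc : continuous F by move=> y; exact: cvg_snd.
exact: (linear_differentiable z Fc).
Qed.

End Pairs.

Section LieCalculus.
Variables (R : realType) (n : nat) (G : TopologicalSpaceGroup.type).
Local Notation C := (Cplx R).
Local Notation V := 'rV[C]_n.
Variable S : complex_lie_group R n G.
Implicit Types (phi psi chi : chart R n G) (p g h : G) (x u v : V).
Local Notation E := (chart_at S).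
Local Notation L := (@left_translation G).

Lemma left_cts g : continuous (L g).
Proof.
move=> h; apply: (@continuous_comp _ _ _ (fun h : G => (g, h)) (fun z : G * G => (z.1 * z.2)%g)).
  apply: cvg_pair; [exact: cvg_cst|exact: cvg_id].
exact: (lie_mul_cts S).
Qed.

Lemma left_hol g p : hol_at S (L g) p.
Proof.
split; first exact: left_cts.
move=> phi psi a1 a2 d1 d2.
have H := lie_mul_hol (chart_at_atlas S g) a1 a2 (chart_at_dom S g) d1 d2.
have [H' _] := diff_snd_slot H.
by move: H'; rewrite /= (chart_mapK (chart_at_dom S g)).
Qed.

Lemma mdiff_left_comp g h p v :
  mdiff S (L g) (h * p)%g (mdiff S (L h) p v) = mdiff S (L (g * h)%g) p v.
Proof.
have := mdiff_comp v (left_hol h p) (left_hol g (L h p)).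
rewrite (_ : L g \o L h = L (g * h)%g) //.
by apply/funext => k; rewrite /left_translation /= mulgA.
Qed.

Lemma mdiff_left1 p v : mdiff S (L 1%g) p v = v.
Proof.
have L1 : L 1%g = id by apply/funext => k; rewrite /left_translation mul1g.
by rewrite L1; exact: (diff_chart_id (chart_at_dom S p)).2.
Qed.

Lemma mdiff_lin f p : linear (mdiff S f p).
Proof. by move=> a u v; rewrite /mdiff linearP. Qed.

Lemma left_field_lin p : linear (left_field S ^~ p).
Proof. exact: mdiff_lin. Qed.

Lemma left_field_rel g h x : mdiff S (L g) h (left_field S x h) = left_field S x (g * h)%g.
Proof. by have := mdiff_left_comp g h 1%g x; rewrite mulg1. Qed.

Lemma left_field1 x : left_field S x 1%g = x.
Proof. exact: mdiff_left1. Qed.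

(** Left translation trivialises the tangent bundle: every tangent vector is the value of a
    left-invariant field. *)
Lemma left_fieldK p v : left_field S (mdiff S (L p^-1%g) p v) p = v.
Proof.
by have := mdiff_left_comp p p^-1%g p v; rewrite mulVg mulgV mdiff_left1.
Qed.

Lemma mul_hol_near phi psi chi g h :
  atlas S phi -> atlas S psi -> atlas S chi ->
  chart_dom phi g -> chart_dom psi h -> chart_dom chi (g * h)%g ->
  \forall z \near (chart_map phi g, chart_map psi h),
    differentiable (fun z : V * V =>
      chart_map chi (chart_inv phi z.1 * chart_inv psi z.2)%g) z.
Proof.
move=> a1 a2 a3 d1 d2 d3.
have N1 := chart_near d1 (chart_dom_nbhs d1).
have N2 := chart_near d2 (chart_dom_nbhs d2).
have c : {for (chart_map phi g, chart_map psi h),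
    continuous (fun z : V * V => (chart_inv phi z.1 * chart_inv psi z.2)%g)}.
  apply: (@continuous_comp _ _ _ (fun z : V * V => (chart_inv phi z.1, chart_inv psi z.2))
     (fun z : G * G => (z.1 * z.2)%g)); last exact: (lie_mul_cts S).
  apply: cvg_pair; [apply: (cvg_comp _ _ cvg_fst)|apply: (cvg_comp _ _ cvg_snd)].
    exact: (chart_inv_cvg d1).
  exact: (chart_inv_cvg d2).
have N3 : nbhs (chart_map phi g, chart_map psi h)
    ((fun z : V * V => (chart_inv phi z.1 * chart_inv psi z.2)%g) @^-1` chart_dom chi).
  by apply: c; rewrite /= !chart_mapK //; exact: chart_dom_nbhs.
have M1 := @cvg_fst _ _ (nbhs (chart_map phi g)) (nbhs (chart_map psi h)) _ _ N1.
have M2 := @cvg_snd _ _ (nbhs (chart_map phi g)) (nbhs (chart_map psi h)) _ _ N2.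
near=> z.
have [_ z1 z2] : [/\ chart_dom phi (chart_inv phi z.1), chart_dom phi (chart_inv phi z.1) &
    chart_map phi (chart_inv phi z.1) = z.1] by near: z; exact: M1.
have [_ w1 w2] : [/\ chart_dom psi (chart_inv psi z.2), chart_dom psi (chart_inv psi z.2) &
    chart_map psi (chart_inv psi z.2) = z.2] by near: z; exact: M2.
have zw : chart_dom chi (chart_inv phi z.1 * chart_inv psi z.2)%g by near: z; exact: N3.
have := lie_mul_hol a1 a2 a3 z1 w1 zw; rewrite z2 w2.
by rewrite -surjective_pairing.
Unshelve. all: by end_near. Qed.

(** Using the multiplication of both arguments instead of a single translation makes the dependence
    on p explicit: one fixed map, differentiated at a moving point in a fixed direction. *)
Lemma field_in_left phi p x : atlas S phi -> chart_dom phi p ->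
  field_in S phi (left_field S x) (chart_map phi p) =
  'd (fun z : V * V => chart_map phi (chart_inv phi z.1 * chart_inv (E 1%g) z.2)%g)
    (chart_map phi p, chart_map (E 1%g) 1%g) (0, x).
Proof.
move=> a d; rewrite /field_in chart_mapK //.
have aE := chart_at_atlas S (1%g : G); have dE := chart_at_dom S (1%g : G).
have d' : chart_dom phi (p * 1)%g by rewrite mulg1.
have H := lie_mul_hol a aE a d dE d'.
have [_ H2] := diff_snd_slot H.
have := to_chart_mdiff x (left_hol p 1%g) aE a dE d'.
rewrite {1}/left_translation mulg1 -/(left_field S x p) => ->.
rewrite to_chart_id.
have Fe : chart_map phi \o L p \o chart_inv (E 1%g) =
    (fun w : V => chart_map phi (chart_inv phi (chart_map phi p) * chart_inv (E 1%g) w)%g).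
  by apply/funext => w; rewrite (chart_mapK d).
exact: (etrans (congr1 (fun F : V -> V => 'd F (chart_map (E 1%g) 1%g) x) Fe) (H2 x)).
Qed.

(** By [field_in_left] this is the differentiability of a first differential of the
    multiplication. *)
Lemma left_field_hol x U : hol_field S U (left_field S x).
Proof.
move=> phi p a _ d.
have aE := chart_at_atlas S (1%g : G); have dE := chart_at_dom S (1%g : G).
have d' : chart_dom phi (p * 1)%g by rewrite mulg1.
have [dm _] := second_diff_row (mul_hol_near a aE a d dE d').
have dp : differentiable (fun z : V => (z, chart_map (E 1%g) 1%g)) (chart_map phi p).
  exact: differentiable_pair_cst.
have dc := differentiable_comp dp (dm (0, x)).
have Ne : \forall z \near chart_map phi p,
   'd (fun z : V * V => chart_map phi (chart_inv phi z.1 * chart_inv (E 1%g) z.2)%g)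
    (z, chart_map (E 1%g) 1%g) (0, x) = field_in S phi (left_field S x) z.
  apply: filterS (chart_near d (chart_dom_nbhs d)) => z [_ z1 z2].
  by have := field_in_left x a z1; rewrite z2 => ->.
exact: (near_eq_differentiable Ne dc).1.
Qed.

End LieCalculus.

(** * Left invariance of the bracket *)

Section LieBracket.
Variables (R : realType) (n : nat) (G : TopologicalSpaceGroup.type).
Local Notation C := (Cplx R).
Local Notation V := 'rV[C]_n.
Variable S : complex_lie_group R n G.
Implicit Types (phi psi chi : chart R n G) (p g h : G) (x y u v : V).
Local Notation E := (chart_at S).
Local Notation L := (@left_translation G).

Lemma field_in_at phi X p : chart_dom phi p ->
  field_in S phi X (chart_map phi p) = to_chart S phi p (X p).
Proof. by move=> d; rewrite /field_in chart_mapK. Qed.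

Lemma mdiffB f p u v : mdiff S f p (u - v) = mdiff S f p u - mdiff S f p v.
Proof. exact: linearB. Qed.

(* Left invariance of [left_field x], differentiated once in the charts at [1]
   and [g]; the second derivative of the left translation is symmetric and
   cancels from the bracket. *)
Lemma diff_field_in_left g x v :
  let l := chart_map (E g) \o L g \o chart_inv (E 1%g) in
  'd (field_in S (E g) (left_field S x)) (chart_map (E g) g) (mdiff S (L g) 1%g v) =
  'd (fun w => 'd l w x) (chart_map (E 1%g) 1%g) v +
  mdiff S (L g) 1%g ('d (field_in S (E 1%g) (left_field S x)) (chart_map (E 1%g) 1%g) v).
Proof.
move=> l.
have a1 := chart_at_atlas S (1%g : G); have d1 := chart_at_dom S (1%g : G).
have ag := chart_at_atlas S g; have dg := chart_at_dom S g.
have dg1 : chart_dom (E g) (L g 1%g) by rewrite /left_translation mulg1.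
have mE u : mdiff S (L g) 1%g u = 'd l (chart_map (E 1%g) 1%g) u.
  by rewrite /mdiff /l /left_translation mulg1.
have N : \forall w \near chart_map (E 1%g) 1%g, [/\ chart_dom (E g) (L g (chart_inv (E 1%g) w)),
    chart_dom (E 1%g) (chart_inv (E 1%g) w) & chart_map (E 1%g) (chart_inv (E 1%g) w) = w].
  have Ng : nbhs (1%g : G) (L g @^-1` chart_dom (E g)).
    by apply: (left_cts S (g := g)); exact: chart_dom_nbhs.
  exact: chart_near d1 Ng.
have dl : \forall w \near chart_map (E 1%g) 1%g, differentiable l w.
  apply: filterS N => w [w1 w2 w3]; rewrite -w3.
  exact: (left_hol S g (chart_inv (E 1%g) w)).2.
have dX1 : differentiable (field_in S (E 1%g) (left_field S x)) (chart_map (E 1%g) 1%g).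
  exact: (left_field_hol x (U := setT)).
have dXg : differentiable (field_in S (E g) (left_field S x)) (chart_map (E g) g).
  exact: (left_field_hol x (U := setT)).
have [sd _] := second_diff_row dl.
have [dA dAE] := diff_apply (B := fun w => 'd l w) (fun w => linearP _) sd dX1.
have lE : l (chart_map (E 1%g) 1%g) = chart_map (E g) g.
  by rewrite /l /= chart_mapK // /left_translation mulg1.
have Ne : \forall w \near chart_map (E 1%g) 1%g,
    'd l w (field_in S (E 1%g) (left_field S x) w) =
    (field_in S (E g) (left_field S x) \o l) w.
  apply: filterS N => w [w1 w2 w3].
  have := to_chart_mdiff (left_field S x (chart_inv (E 1%g) w))
     (left_hol S g (chart_inv (E 1%g) w)) a1 ag w2 w1.
  rewrite left_field_rel w3 => H.
  refine (etrans (esym H) _).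
  by rewrite /field_in /l /= chart_mapK.
have dl1 := nbhs_singleton dl.
have dXl : differentiable (field_in S (E g) (left_field S x)) (l (chart_map (E 1%g) 1%g)).
  by rewrite lE.
have dcE := congr1 (fun T : V -> V => T v) (diff_comp dl1 dXl).
have neE := congr1 (fun T : V -> V => T v) (near_eq_differentiable Ne dA).2.
have := etrans (esym dcE) (etrans neE (dAE v)).
rewrite /= lE !mE (field_in_at _ d1) to_chart_id left_field1.
exact.
Qed.

Lemma bracket_left g x y :
  lie_bracket S (left_field S x) (left_field S y) g = left_field S (ad S x y) g.
Proof.
have H1 := diff_field_in_left g y x; have H2 := diff_field_in_left g x y.
have a1 := chart_at_atlas S (1%g : G); have d1 := chart_at_dom S (1%g : G).
set l := chart_map (E g) \o L g \o chart_inv (E 1%g) in H1 H2.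
have sym : 'd (fun w => 'd l w x) (chart_map (E 1%g) 1%g) y =
           'd (fun w => 'd l w y) (chart_map (E 1%g) 1%g) x.
  apply: (second_diff_row _).2.
  have Ng : nbhs (1%g : G) (L g @^-1` chart_dom (E g)).
    apply: (left_cts S (g := g)); rewrite /left_translation mulg1.
    exact: chart_dom_nbhs (chart_at_dom S g).
  apply: filterS (chart_near d1 Ng) => w [w1 w2 w3]; rewrite -w3.
  exact: (left_hol S g (chart_inv (E 1%g) w)).2 a1 (chart_at_atlas S g) w2 w1.
rewrite /lie_bracket; refine (etrans (congr2 (fun a b => a - b) H1 H2) _).
have cancel (s p q r : V) : s = r -> s + p - (r + q) = p - q.
  by move=> ->; rewrite opprD addrACA subrr add0r.
refine (etrans (cancel _ _ _ _ (esym sym)) _).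
refine (etrans (esym (mdiffB _ _ _ _)) _).
refine (congr1 (mdiff S (L g) 1%g) _).
exact: esym (congr2 (fun a b =>
  'd (field_in S (E 1%g) (left_field S y)) (chart_map (E 1%g) 1%g) a -
  'd (field_in S (E 1%g) (left_field S x)) (chart_map (E 1%g) 1%g) b)
  (left_field1 S x) (left_field1 S y)).
Qed.

End LieBracket.

(** * Holomorphic curves and their associated curves *)

Section Curves.
Variables (R : realType) (n : nat) (G : TopologicalSpaceGroup.type).
Local Notation C := (Cplx R).
Local Notation V := 'rV[C]_n.
Variable S : complex_lie_group R n G.
Implicit Types (phi psi chi : chart R n G) (p g h : G) (x y u v : V).
Local Notation E := (chart_at S).
Local Notation L := (@left_translation G).

Lemma mul_through (N : normedModType C) (a : N) (h1 h2 : N -> G) phi1 phi2 chi :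
  atlas S phi1 -> atlas S phi2 -> atlas S chi ->
  chart_dom phi1 (h1 a) -> chart_dom phi2 (h2 a) -> chart_dom chi (h1 a * h2 a)%g ->
  {for a, continuous h1} -> {for a, continuous h2} ->
  differentiable (chart_map phi1 \o h1) a ->
  differentiable (chart_map phi2 \o h2) a ->
  differentiable (fun s => chart_map chi (h1 s * h2 s)%g) a.
Proof.
move=> a1 a2 a3 d1 d2 d3 c1 c2 dh1 dh2.
have dm := lie_mul_hol a1 a2 a3 d1 d2 d3.
have dp := differentiable_pair dh1 dh2.
have dc := differentiable_comp dp dm.
have N1 : nbhs a (h1 @^-1` chart_dom phi1) by exact: c1 _ (chart_dom_nbhs d1).
have N2 : nbhs a (h2 @^-1` chart_dom phi2) by exact: c2 _ (chart_dom_nbhs d2).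
refine (near_eq_differentiable _ dc).1.
by apply: filterS2 N1 N2 => s /= s1 s2; rewrite !chart_mapK.
Qed.

(** Left division in charts. Its differential in the second slot on the diagonal is the
    Maurer-Cartan form, which sends the velocity to the associated curve. *)
Definition ldiv_chart phi (z : V * V) : V :=
  chart_map (E 1%g) ((chart_inv phi z.1)^-1 * chart_inv phi z.2)%g.

Lemma ldiv_chart_hol phi g h : atlas S phi -> chart_dom phi g -> chart_dom phi h ->
  chart_dom (E 1%g) (g^-1 * h)%g ->
  differentiable (ldiv_chart phi) (chart_map phi g, chart_map phi h).
Proof.
move=> a dg dh d1.
have [ci di] := @lie_inv_hol R n G S g I.
apply: (@mul_through _ (chart_map phi g, chart_map phi h)
  (fun z : V * V => (chart_inv phi z.1)^-1%g) (fun z : V * V => chart_inv phi z.2)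
  (E g^-1%g) phi (E 1%g)) => //=; rewrite ?chart_mapK //.
- exact: chart_at_atlas.
- exact: chart_at_atlas.
- exact: chart_at_dom.
- apply: (@continuous_comp _ _ _ (fun z : V * V => chart_inv phi z.1) (fun g : G => g^-1%g)).
    apply: (@continuous_comp _ _ _ (fun z : V * V => z.1) (chart_inv phi)).
      exact: cvg_fst.
    exact: chart_inv_cvg.
  by rewrite /= chart_mapK.
- apply: (@continuous_comp _ _ _ (fun z : V * V => z.2) (chart_inv phi)).
    exact: cvg_snd.
  exact: chart_inv_cvg.
- have df : differentiable (fun z : V * V => z.1) (chart_map phi g, chart_map phi h).
    exact: differentiable_fst.
  have dgi := di _ _ a (chart_at_atlas S g^-1%g) dg (chart_at_dom S g^-1%g).
  exact: (differentiable_comp df dgi).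
- have df : differentiable (fun z : V * V => z.2) (chart_map phi g, chart_map phi h).
    exact: differentiable_snd.
  exact: (differentiable_comp df (diff_chart_id dh).1).
Qed.

Lemma ldiv_chart_near phi g : atlas S phi -> chart_dom phi g ->
  \forall z \near (chart_map phi g, chart_map phi g), differentiable (ldiv_chart phi) z.
Proof.
move=> a d.
have N1 := chart_near d (chart_dom_nbhs d).
have M1 := @cvg_fst _ _ (nbhs (chart_map phi g)) (nbhs (chart_map phi g)) _ _ N1.
have M2 := @cvg_snd _ _ (nbhs (chart_map phi g)) (nbhs (chart_map phi g)) _ _ N1.
have c : {for (chart_map phi g, chart_map phi g),
    continuous (fun z : V * V => ((chart_inv phi z.1)^-1 * chart_inv phi z.2)%g)}.
  apply: (@continuous_comp _ _ _
     (fun z : V * V => ((chart_inv phi z.1)^-1%g, chart_inv phi z.2))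
     (fun z : G * G => (z.1 * z.2)%g)); last exact: (lie_mul_cts S).
  apply: cvg_pair; last by apply: (cvg_comp _ _ cvg_snd); exact: (chart_inv_cvg d).
  apply: (@continuous_comp _ _ _ (fun z : V * V => chart_inv phi z.1) (fun g : G => g^-1%g)).
    by apply: (cvg_comp _ _ cvg_fst); exact: (chart_inv_cvg d).
  by rewrite /= chart_mapK //; have [] := @lie_inv_hol R n G S g I.
have N3 : nbhs (chart_map phi g, chart_map phi g)
    ((fun z : V * V => ((chart_inv phi z.1)^-1 * chart_inv phi z.2)%g) @^-1` chart_dom (E 1%g)).
  apply: c; rewrite /= !chart_mapK // mulVg.
  exact: chart_dom_nbhs (chart_at_dom _ _).
near=> z.
have [_ z1 z2] : [/\ chart_dom phi (chart_inv phi z.1), chart_dom phi (chart_inv phi z.1) &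
    chart_map phi (chart_inv phi z.1) = z.1] by near: z; exact: M1.
have [_ w1 w2] : [/\ chart_dom phi (chart_inv phi z.2), chart_dom phi (chart_inv phi z.2) &
    chart_map phi (chart_inv phi z.2) = z.2] by near: z; exact: M2.
have zw : chart_dom (E 1%g) ((chart_inv phi z.1)^-1 * chart_inv phi z.2)%g.
  by near: z; exact: N3.
have := ldiv_chart_hol a z1 w1 zw; rewrite z2 w2.
by rewrite -surjective_pairing.
Unshelve. all: by end_near. Qed.

Variables (A : set C) (gamma : C -> G).
Hypotheses (hA : open A) (hgamma : hol_curve S A gamma).
Implicit Types t s : C.

Lemma curve_near phi t : A t -> chart_dom phi (gamma t) ->
  \forall s \near (t : C^o), A s /\ chart_dom phi (gamma s).
Proof.
move=> At d; have [ct _] := hgamma At.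
have N1 : nbhs t A by apply: open_nbhs_nbhs.
have N2 : nbhs t (gamma @^-1` chart_dom phi) by exact: ct _ (chart_dom_nbhs d).
by apply: filterS2 N1 N2.
Qed.

(** [velocity] at s is read in the chart preferred at [gamma s], which varies with s; in a fixed
    chart it is the ordinary derivative. *)
Lemma to_chart_velocity phi s : A s -> atlas S phi -> chart_dom phi (gamma s) ->
  to_chart S phi (gamma s) (velocity S gamma s) =
  'd (chart_map phi \o gamma : C^o -> V) (s : C^o) (1 : C^o).
Proof.
move=> As a d; have [cs ds] := hgamma As.
have aE := chart_at_atlas S (gamma s); have dE := chart_at_dom S (gamma s).
have dEs : differentiable (chart_map (E (gamma s)) \o gamma : C^o -> V) (s : C^o).
  exact: ds.
have [|||| _ H] := @diff_through_chart R n G C^o V s gamma (chart_map phi) (E (gamma s)).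
- exact: cs.
- exact: dE.
- exact: dEs.
- exact: (transition_hol aE a).
refine (etrans _ (esym (H 1))).
by rewrite /velocity (derive1E' dEs).
Qed.

Lemma velocityE s : A s -> velocity S gamma s =
  'd (chart_map (E (gamma s)) \o gamma : C^o -> V) (s : C^o) (1 : C^o).
Proof.
move=> As; rewrite -(to_chart_velocity As (chart_at_atlas _ _) (chart_at_dom _ _)).
by rewrite to_chart_id.
Qed.

Lemma curve_second_diff phi t : A t -> atlas S phi -> chart_dom phi (gamma t) ->
  differentiable (fun s : C^o => 'd (chart_map phi \o gamma : C^o -> V) s (1 : C^o)) (t : C^o).
Proof.
move=> At a d.
apply: (second_diff_row _).1.
by apply: filterS (curve_near At d) => s [As ds]; exact: (hgamma As).2.
Qed.

Lemma associated_curve_chart phi s : A s -> atlas S phi -> chart_dom phi (gamma s) ->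
  associated_curve S gamma s =
  'd (ldiv_chart phi) (chart_map phi (gamma s), chart_map phi (gamma s))
     (0, 'd (chart_map phi \o gamma : C^o -> V) (s : C^o) (1 : C^o)).
Proof.
move=> As a d; have a1 := chart_at_atlas S (1%g : G); have d1 := chart_at_dom S (1%g : G).
have d1' : chart_dom (E 1%g) (L (gamma s)^-1%g (gamma s)) by rewrite /left_translation mulVg.
have H := to_chart_mdiff (velocity S gamma s) (left_hol S (gamma s)^-1%g (gamma s)) a a1 d d1'.
have [_ H2] := diff_snd_slot (ldiv_chart_hol a d d d1').
have H3 := to_chart_velocity As a d.
have Lid : to_chart S (E 1%g) (L (gamma s)^-1%g (gamma s))
   (mdiff S (L (gamma s)^-1%g) (gamma s) (velocity S gamma s)) = associated_curve S gamma s.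
  by rewrite {1}/left_translation mulVg to_chart_id.
refine (etrans (esym Lid) (etrans H _)).
refine (etrans (congr1 _ H3) _).
refine (etrans _ (H2 _)).
refine (congr1 (fun F : V -> V => 'd F _ _) _).
by apply/funext => w; rewrite /ldiv_chart /= chart_mapK.
Qed.

Lemma differentiable_associated_curve t : A t ->
  differentiable (associated_curve S gamma : C^o -> V) (t : C^o).
Proof.
move=> At; set phi := E (gamma t).
have a : atlas S phi := chart_at_atlas S (gamma t).
have d : chart_dom phi (gamma t) := chart_at_dom S (gamma t).
have dc : differentiable (chart_map phi \o gamma : C^o -> V) (t : C^o).
  exact: (hgamma At).2.
have [sd _] := second_diff_row (ldiv_chart_near a d).
pose B (s : C^o) (u : V) :=
  'd (ldiv_chart phi) (chart_map phi (gamma s), chart_map phi (gamma s)) (0 : V, u).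
have Blin s : linear (B s).
  move=> k u v; rewrite /B -linearP; congr ('d _ _ (_, _)).
  by rewrite /= scaler0 addr0.
have dB u : differentiable (B^~ u) (t : C^o).
  exact: (differentiable_comp (differentiable_pair dc dc) (sd (0, u))).
have [dBX _] := diff_apply Blin dB (curve_second_diff At a d).
refine (near_eq_differentiable _ dBX).1.
apply: filterS (curve_near At d) => s [As ds].
exact: esym (associated_curve_chart As a ds).
Qed.

Lemma velocity_left_field s :
  velocity S gamma s = left_field S (associated_curve S gamma s) (gamma s).
Proof. by rewrite /associated_curve left_fieldK. Qed.

(** Product rule for the velocity written as x(s) in the left-invariant frame: the first term moves
    the point with x(t) frozen, the second differentiates x. *)
Lemma derive_velocity t : A t ->
  derive1 (fun s => to_chart S (E (gamma t)) (gamma s) (velocity S gamma s)) t =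
  'd (field_in S (E (gamma t)) (left_field S (associated_curve S gamma t)))
     (chart_map (E (gamma t)) (gamma t)) (velocity S gamma t) +
  left_field S (derive1 (associated_curve S gamma) t) (gamma t).
Proof.
move=> At; set phi := E (gamma t).
have a : atlas S phi := chart_at_atlas S (gamma t).
have d : chart_dom phi (gamma t) := chart_at_dom S (gamma t).
have dc : differentiable (chart_map phi \o gamma : C^o -> V) (t : C^o).
  exact: (hgamma At).2.
pose B (s : C^o) (u : V) := field_in S phi (left_field S u) (chart_map phi (gamma s)).
have Blin s : linear (B s).
  move=> k u v; rewrite /B /field_in -to_chart_lin; congr (to_chart _ _ _ _).
  exact: left_field_lin.
have dF u := left_field_hol (S := S) u (U := setT) a I d.
have dB u : differentiable (B^~ u) (t : C^o) by exact: (differentiable_comp dc (dF u)).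
have dx := differentiable_associated_curve At.
have [dBX dE] := diff_apply Blin dB dx.
have Ne : \forall s \near (t : C^o), B s (associated_curve S gamma s) =
    to_chart S phi (gamma s) (velocity S gamma s).
  apply: filterS (curve_near At d) => s [As ds].
  by rewrite /B (field_in_at _ _ ds) -velocity_left_field.
have [dv vE] := near_eq_differentiable Ne dBX.
refine (etrans (derive1E' dv) _).
refine (etrans (congr1 (fun T : C^o -> V => T 1) vE) (etrans (dE 1) _)).
refine (congr2 (fun u v : V => u + v) _ _).
  refine (etrans (congr1 (fun T : C^o -> V => T 1) (diff_comp dc (dF _))) _).
  refine (congr1 (fun u : V => 'd (field_in S phi
    (left_field S (associated_curve S gamma t))) (chart_map phi (gamma t)) u) _).
  exact: esym (velocityE At).
rewrite /B (field_in_at _ _ d) to_chart_id.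
refine (congr1 (fun u => left_field S u (gamma t)) _).
exact: esym (derive1E' dx).
Qed.

End Curves.

(** * The Levi-Civita connection *)

Section Connection.
Variables (R : realType) (n : nat) (M : topologicalType).
Local Notation C := (Cplx R).
Local Notation V := 'rV[C]_n.
Variable S : complex_manifold R n M.
Implicit Types (phi psi : chart R n M) (p r : M) (u v : V) (X Y : M -> V) (U : set M).
Local Notation E := (chart_at S).

(** In another chart the field is a differential of a transition map, so second differentials enter
    here too. *)
Lemma coord_field_hol phi u : atlas S phi ->
  hol_field S (chart_dom phi) (coord_field S phi u).
Proof.
move=> a psi p b dp dq.
have dt := transition_hol b a dq dp.
have [sd _] := second_diff_row (transition_hol_near a b dp dq).
have sdu : differentiable (fun w => 'd (chart_map psi \o chart_inv phi) w u)
    ((chart_map phi \o chart_inv psi) (chart_map psi p)).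
  have e : (chart_map phi \o chart_inv psi) (chart_map psi p) = chart_map phi p.
    exact: congr1 (chart_mapK dq).
  by rewrite e; exact: sd.
refine (near_eq_differentiable _ (differentiable_comp dt sdu)).1.
apply: filterS (chart_near dq (chart_dom_nbhs dp)) => z [z1 z2 z3].
exact: (transition_comp u a (chart_at_atlas S _) b z1 (chart_at_dom S _) z2).
Qed.

Lemma hol_fieldD U X Y : hol_field S U X -> hol_field S U Y ->
  hol_field S U (fun r => X r + Y r).
Proof.
move=> hX hY phi p a Up d.
rewrite (_ : field_in S phi _ = field_in S phi X + field_in S phi Y).
  exact: (differentiableD (hX phi p a Up d) (hY phi p a Up d)).
apply/funext => z; exact: (linearD ('d (chart_map phi \o chart_inv (E (chart_inv phi z)))
    (chart_map (E (chart_inv phi z)) (chart_inv phi z)) : {linear V -> V})).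
Qed.

Lemma hol_field0 U : hol_field S U (fun=> 0).
Proof.
move=> phi p a Up d.
rewrite (_ : field_in S phi _ = cst 0); first exact: differentiable_cst.
apply/funext => z; exact: (linear0 ('d (chart_map phi \o chart_inv (E (chart_inv phi z)))
    (chart_map (E (chart_inv phi z)) (chart_inv phi z)) : {linear V -> V})).
Qed.

Lemma hol_fieldZ U (f : M -> C) X : hol_fun S U f -> hol_field S U X ->
  hol_field S U (fun r => f r *: X r).
Proof.
move=> hf hX phi p a Up d.
rewrite (_ : field_in S phi _ = (fun z => (f \o chart_inv phi) z *: field_in S phi X z)).
  apply: differentiable_row => j.
  rewrite (_ : (fun w => _) =
    (fun w => (f \o chart_inv phi) w * field_in S phi X w ord0 j : C^o)).
    have dX := (diff_coord j (hX phi p a Up d)).1.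
    exact: (@differentiableM C V (f \o chart_inv phi)
      (fun w => field_in S phi X w ord0 j) _ (hf phi p a Up d) dX).
  by apply/funext => w; rewrite mxE.
apply/funext => z; exact: (linearZZ ('d (chart_map phi \o chart_inv (E (chart_inv phi z)))
    (chart_map (E (chart_inv phi z)) (chart_inv phi z)) : {linear V -> V})).
Qed.

Variable nabla : (M -> V) -> M -> V -> V.
Hypothesis hn : hol_connection S nabla.

Lemma nabla_sum U (I : Type) (s : seq I) (F : I -> M -> V) :
  open U -> (forall i, hol_field S U (F i)) ->
  hol_field S U (fun r => \sum_(i <- s) F i r) /\ forall p v, U p ->
  nabla (fun r => \sum_(i <- s) F i r) p v = \sum_(i <- s) nabla (F i) p v.
Proof.
move=> oU hF; elim: s => [|i s [IHh IHn]].
  rewrite (_ : (fun r => \sum_(i <- [::]) F i r) = fun=> 0); last first.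
    by apply/funext => r; rewrite big_nil.
  split; first exact: hol_field0.
  (* The zero field is its own double, so additivity makes its covariant derivative vanish. *)
  move=> p v Up; have := nabla_add hn oU (hol_field0 (U := U)) (hol_field0 (U := U)) v Up.
  rewrite addr0 -[LHS]addr0 => /addrI H; rewrite big_nil.
  by rewrite -H.
rewrite (_ : (fun r => \sum_(j <- i :: s) F j r) = fun r => F i r + \sum_(j <- s) F j r); last first.
  by apply/funext => r; rewrite big_cons.
split; first exact: hol_fieldD.
move=> p v Up; rewrite big_cons -(IHn p v Up).
exact: (nabla_add hn oU (hF i) IHh v Up).
Qed.

(** On the chart domain X is a combination of coordinate fields, and Leibniz' rule applies to it by
    locality. The sum on the right is the one in [covariant_derivative], which allows the comparison
    along a curve. *)
Lemma nabla_coord X p v : hol_field S setT X ->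
  nabla X p v = 'd (field_in S (E p) X) (chart_map (E p) p) v +
    \sum_(i < n) X p ord0 i *: nabla (coord_field S (E p) (delta_mx ord0 i)) p v.
Proof.
move=> hX; set phi := E p; set U := chart_dom phi.
have a : atlas S phi := chart_at_atlas S p.
have Up : U p := chart_at_dom S p.
have oU : open U by exact: chart_dom_open.
pose f i r : C := to_chart S phi r (X r) ord0 i.
pose e i := coord_field S phi (delta_mx ord0 i).
have he i : hol_field S U (e i) by exact: coord_field_hol.
have hf i : hol_fun S U (f i).
  move=> psi r b Ur dr.
  have [|||| d _] := @diff_through_chart R n M V C^o (chart_map psi r) (chart_inv psi) (f i) phi.
  - exact: chart_inv_cvg.
  - by rewrite chart_mapK.
  - exact: (transition_hol b a).
  - rewrite chart_mapK //.
    exact: (diff_coord i (hX phi r a I Ur)).1.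
  exact: d.
have hX' : hol_field S U X by move=> psi r b _ dr; exact: hX.
have hfe i := hol_fieldZ (hf i) (he i).
have [hs sE] := nabla_sum (index_enum 'I_n) oU hfe.
have XE r : U r -> X r = \sum_(i < n) f i r *: e i r.
  move=> Ur; rewrite -[LHS](of_to_chart (X r) a Ur).
  pose lM := GRing.isLinear.Build _ _ _ _ _ (@of_chart_lin R n M S phi r).
  pose F : {linear V -> V} := HB.pack (of_chart S phi r) lM.
  rewrite -[of_chart S phi r]/(F : V -> V) [in LHS](row_sum_delta (to_chart S phi r (X r))).
  by rewrite linear_sum; apply: eq_bigr => i _; rewrite linearZ.
refine (etrans (nabla_local hn oU hX' hs XE v Up) _).
refine (etrans (sE p v Up) _).
have step i : nabla (fun r => f i r *: e i r) p v =
    'd (field_in S phi X) (chart_map phi p) v ord0 i *: delta_mx ord0 i +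
    X p ord0 i *: nabla (e i) p v.
  refine (etrans (nabla_leibniz hn oU (hf i) (he i) v Up) _).
  refine (congr2 (fun u w : V => u + w) _ _).
    refine (congr2 (fun (k : C) (w : V) => k *: w) _ _).
      exact: ((diff_coord i (hX phi p a I Up)).2 v).
    exact: of_chart_id.
  by rewrite /f to_chart_id.
rewrite (eq_bigr _ (fun i _ => step i)) big_split /=.
by rewrite -row_sum_delta.
Qed.

End Connection.

(** * Left-invariant metrics: Koszul's formula and the adjoint *)

Section Koszul.
Variables (R : realType) (n : nat) (G : TopologicalSpaceGroup.type).
Local Notation C := (Cplx R).
Local Notation V := 'rV[C]_n.
Variables (S : complex_lie_group R n G) (q : G -> V -> V -> C).
Hypotheses (hq : hol_metric S q) (hinv : left_invariant_metric S q).
Variable nabla : (G -> V) -> G -> V -> V.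
Hypothesis hnabla : levi_civita S q nabla.
Implicit Types (p : G) (u v w x z : V).

Lemma metricDl p u v w : q p (u + v) w = q p u w + q p v w.
Proof.
rewrite (Defs.metric_sym hq) -[u in LHS]scale1r (metric_linear hq) mul1r.
by rewrite (Defs.metric_sym hq) (Defs.metric_sym hq p w).
Qed.

Lemma metricNl p u w : q p (- u) w = - q p u w.
Proof.
have q0 : q p 0 w = 0.
  have := metricDl p 0 0 w; rewrite addr0 -[LHS]addr0 => /addrI /esym //.
by apply/eqP; rewrite -subr_eq0 opprK -metricDl addNr q0.
Qed.

Lemma metric_left_field p u v : q p (left_field S u p) (left_field S v p) = q 1%g u v.
Proof. by have := hinv p 1%g u v; rewrite /left_translation mulg1. Qed.

(* Koszul's formula for left-invariant fields, on which [q] is constant. *)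
Lemma koszul_left p x z :
  q p (nabla (left_field S x) p (left_field S x p)) (left_field S z p) =
  - q 1%g x (ad S x z).
Proof.
case: hnabla => hn ht hm.
have hX y := left_field_hol (S := S) y (U := setT).
have met y1 y2 v : q p (nabla (left_field S y1) p v) (left_field S y2 p) +
    q p (left_field S y1 p) (nabla (left_field S y2) p v) = 0.
  refine (etrans (esym (hm setT _ _ openT (hX y1) (hX y2) p v I)) _).
  have -> : (fun r => q r (left_field S y1 r) (left_field S y2 r)) = cst (q 1%g y1 y2).
    by apply/funext => r; rewrite metric_left_field.
  exact: (congr1 (fun T : V -> C^o => T v)
    (diff_cst (q 1%g y1 y2 : C^o) (chart_map (chart_at S p) p))).
have tor := ht setT _ _ openT (hX x) (hX z) p I.
(* As q(X, X) is constant, nabla_Z X is orthogonal to X. Replacing nabla_X Z by nabla_Z X + [X, Z]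
   in the derivative of q(X, Z) along X then leaves only the bracket. *)
have := met x x (left_field S z p); rewrite [X in X + _](Defs.metric_sym hq) => H0.
have Hz : q p (left_field S x p) (nabla (left_field S x) p (left_field S z p)) = 0.
  apply/eqP; move/eqP: H0; rewrite -mulr2n -mulr_natl mulf_eq0 => /orP[|//].
  by rewrite pnatr_eq0.
have := met x z (left_field S x p).
have -> : nabla (left_field S z) p (left_field S x p) =
    nabla (left_field S x) p (left_field S z p) + left_field S (ad S x z) p.
  by rewrite -bracket_left -tor addrC subrK.
rewrite (Defs.metric_sym hq p (left_field S x p)) metricDl.
rewrite (Defs.metric_sym hq p _ (left_field S x p)) Hz add0r.
rewrite (Defs.metric_sym hq p _ (left_field S x p)) metric_left_field.
by move/eqP; rewrite addr_eq0 => /eqP.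
Qed.

Lemma metric_inj w w' : (forall z, q 1%g w z = q 1%g w' z) -> w = w'.
Proof.
move=> ww; apply/eqP; rewrite -subr_eq0; apply/eqP; apply: (metric_nondeg hq (p := 1%g)) => z.
by rewrite metricDl metricNl ww subrr.
Qed.

(** [adjoint] is a choice with default 0, so its defining property requires a witness. *)
Lemma adjointP x z :
  q 1%g (adjoint (q 1%g) (ad S x) x) z = q 1%g x (ad S x z).
Proof.
have ex : exists w, forall z, q 1%g w z = q 1%g x (ad S x z).
  (* Koszul's formula exhibits the adjoint, so no duality argument is needed. *)
  exists (- nabla (left_field S x) 1%g x) => y.
  have := koszul_left 1%g x y; rewrite !left_field1 metricNl => ->.
  by rewrite opprK.
exact: (xgetPex 0 ex z).
Qed.

End Koszul.

Unset Implicit Arguments.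

Theorem theorem4p1 (R : realType) (n : nat) (G : TopologicalSpaceGroup.type)
  (S : complex_lie_group R n G)
  (q : G -> 'rV[Cplx R]_n -> 'rV[Cplx R]_n -> Cplx R)
  (hq : hol_metric S q) (hinv : left_invariant_metric S q)
  (nabla : (G -> 'rV[Cplx R]_n) -> G -> 'rV[Cplx R]_n -> 'rV[Cplx R]_n)
  (hnabla : levi_civita S q nabla)
  (A : set (Cplx R)) (hAopen : open A) (hAconn : connected A)
  (hAne : A !=set0)
  (gamma : Cplx R -> G) (hgamma : hol_curve S A gamma)
  (himm : immersed S A gamma) :
  geodesic S A gamma nabla <->
  forall t, A t ->
    let x := associated_curve S gamma in
    derive1 x t = adjoint (q 1%g) (ad S (x t)) (x t).
Proof.
set x := associated_curve S gamma.
have hn : hol_connection S nabla by case: hnabla.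
have covE t : A t -> covariant_derivative S gamma nabla (velocity S gamma) t =
    left_field S (derive1 x t) (gamma t) +
    nabla (left_field S (x t)) (gamma t) (left_field S (x t) (gamma t)).
  move=> At; rewrite /covariant_derivative /=.
  refine (etrans (congr1 (fun u => u + _) (derive_velocity hAopen hgamma At)) _).
  rewrite (nabla_coord hn _ _ (left_field_hol (S := S) (x t) (U := setT))).
  rewrite addrAC addrC -/x -(velocity_left_field S gamma t).
  by [].
(* Both implications rest on this pairing: left-invariant fields fill each tangent space, so testing
   against all z at [gamma t] amounts to testing in the Lie algebra. *)
have qcov t z : A t ->
    q (gamma t) (covariant_derivative S gamma nabla (velocity S gamma) t)
      (left_field S z (gamma t)) = q 1%g (derive1 x t) z - q 1%g (x t) (ad S (x t) z).
  move=> At; rewrite covE // (metricDl hq) (metric_left_field hinv).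
  by rewrite (koszul_left hq hinv hnabla).
split=> [geo t At|eqx t At].
  apply: (metric_inj hq) => z; rewrite (adjointP hq hinv hnabla).
  apply/eqP; rewrite -subr_eq0 -qcov // (geo t At); apply/eqP.
  by have := metricDl hq (gamma t) 0 0 (left_field S z (gamma t));
    rewrite addr0 -[LHS]addr0 => /addrI /esym.
apply: (metric_nondeg hq (p := gamma t)) => v.
rewrite -(left_fieldK S (gamma t) v) qcov // (eqx t At).
by rewrite (adjointP hq hinv hnabla) subrr.
Qed.
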